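(* Let $r\ge2$ be an integer and $K$ a triangle. The shape functions for the bubble space $b_K^2R^{r-2}(K)$ associated with the degrees of freedom \[ v\mapsto\frac1{|K|}\int_K v\,P_{k,r-2}^{(2,2,2)}(\lambda_1,\lambda_2,\lambda_3)\,d\boldsymbol x,\qquad k=0,\dots,r-2, \] are \[ a_{k,r-2}\,b_K^2\,P_{k,r-2}^{(2,2,2)}(\lambda_1,\lambda_2,\lambda_3) \] with \[ a_{k,r-2}=\frac{(2r+4)(2k+5)(r+k+4)(r+k+5)(k+3)(k+4)}{2(r-k)(r-1-k)(k+1)(k+2)},\qquad k=0,\dots,r-2. \]
   Context: $K$ is a triangle with barycentric coordinates $\lambda_1,\lambda_2,\lambda_3$ and $b_K=\lambda_1\lambda_2\lambda_3$. With $\mathbb P_m=\{0\}$ for $m<0$, \[ R^{r-2}(K)=\Bigl\{v\in\mathbb P_{r-2}(K):\int_K b_K^2 v q\,d\boldsymbol x=0\ \text{for all }q\in\mathbb P_{r-3}(K)\Bigr\}. \] $P_n^{(\alpha,\beta)}$ ($\alpha,\beta>-1$) is the Jacobi polynomial given by \[ (1-t)^\alpha(1+t)^\beta P_n^{(\alpha,\beta)}(t)=\frac{(-1)^n}{2^nn!}\frac{d^n}{dt^n}\bigl((1-t)^{n+\alpha}(1+t)^{n+\beta}\bigr), \] and for integers $0\le k\le n$ and $\alpha,\beta,\gamma>-1$, on $\lambda_1+\lambda_2+\lambda_3=1$, \[ P_{k,n}^{(\alpha,\beta,\gamma)}(\lambda_1,\lambda_2,\lambda_3)=(\lambda_2+\lambda_3)^kP_{n-k}^{(2k+\beta+\gamma+1,\alpha)}(\lambda_1-\lambda_2-\lambda_3)\,P_k^{(\gamma,\beta)}\Bigl(\frac{\lambda_2-\lambda_3}{\lambda_2+\lambda_3}\Bigr),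 \] which is a polynomial in $\mathbb P_n(K)$. The shape functions of a finite-dimensional space associated with given degrees of freedom are the basis of that space dual to these functionals: the shape function indexed by $k$ gives value $1$ on the degree of freedom indexed by $k$ and $0$ on all others. *)

(* Defs.v *)
From HB Require Import structures.
From mathcomp Require Import all_boot all_order all_algebra.
From mathcomp Require Import all_classical all_reals all_analysis.
From mathcomp Require Import ring lra.
Import Order.TTheory GRing.Theory Num.Theory.
Import numFieldNormedType.Exports.

Set Implicit Arguments.
Unset Strict Implicit.
Unset Printing Implicit Defensive.

Local Open Scope classical_set_scope.
Local Open Scope ring_scope.

Definition rodrigues (R : realType) (n : nat) (alpha beta : R) (p : {poly R}) :=
  forall t : R, -1 < t < 1 ->
  (1 - t) `^ alpha * (1 + t) `^ beta * p.[t] =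
  (-1) ^+ n / (2 ^+ n * n`!%:R) *
  derive1n n
    (fun s : R => (1 - s) `^ (n%:R + alpha) * (1 + s) `^ (n%:R + beta)) t.

(* The polynomial exists (jacobiP) and is unique, the weight being nonzero on
   ]-1, 1[. *)
Definition jacobi (R : realType) (n : nat) (alpha beta : R) : {poly R} :=
  xget 0 [set p | rodrigues n alpha beta p].

Lemma derive1_powR_poly (R : realType) (q : {poly R}) (a b t : R) :
  -1 < t < 1 ->
  derive1 (fun s : R => (1 - s) `^ a * (1 + s) `^ b * q.[s]) t =
  (1 - t) `^ (a - 1) * (1 + t) `^ (b - 1) *
  (deriv q * ((1 - 'X) * (1 + 'X))
   + q * (b *: (1 - 'X) - a *: (1 + 'X))).[t].
Proof.
move=> /andP[t1 t2].
have t1' : 0 < 1 + t by lra.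
have t2' : 0 < 1 - t by lra.
have d1 : is_derive t 1 (fun s : R => (1 - s) `^ a)
    (a * (1 - t) `^ (a - 1) * (0 - 1)).
  exact: (@is_derive1_comp R (@powR R ^~ a) (cst 1 - id) t _ _
    (is_derive1_powR a t2')).
have d2 : is_derive t 1 (fun s : R => (1 + s) `^ b)
    (b * (1 + t) `^ (b - 1) * (0 + 1)).
  exact: (@is_derive1_comp R (@powR R ^~ b) (cst 1 + id) t _ _
    (is_derive1_powR b t1')).
have d12 := is_deriveM (is_deriveM d1 d2) (is_derive_poly q t).
rewrite derive1E (@derive_val _ _ _ _ _ _ _ d12) /GRing.scale /=.
have powRB1 (x y : R) : 0 < x -> x `^ y = x `^ (y - 1) * x.
  move=> x0; have {1}-> : y = (y - 1) + 1 by rewrite subrK.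
  by rewrite (@powRD _ x (y - 1) 1) ?(gt_eqF x0) ?implybT// powRr1// ltW.
rewrite /= !fctE (powRB1 _ a t2') (powRB1 _ b t1').
rewrite !(hornerD, hornerN, hornerM, hornerZ, hornerX, hornerC).
by ring.
Qed.

Lemma jacobiP (R : realType) (n : nat) (alpha beta : R) :
  rodrigues n alpha beta (jacobi n alpha beta).
Proof.
apply: xgetPex.
suff [q qP] : exists q : {poly R}, forall t, -1 < t < 1 ->
    derive1n n (fun s => (1 - s) `^ (n%:R + alpha) * (1 + s) `^ (n%:R + beta)) t
    = (1 - t) `^ alpha * (1 + t) `^ beta * q.[t].
  exists (((-1) ^+ n / (2 ^+ n * n`!%:R)) *: q) => t /qP ->.
  by rewrite hornerZ mulrCA.
set f := (X in derive1n n X).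
suff H m : exists q : {poly R}, forall t, -1 < t < 1 -> derive1n m f t =
    (1 - t) `^ (n%:R + alpha - m%:R) * (1 + t) `^ (n%:R + beta - m%:R) * q.[t].
  by have [q qP] := H n; exists q => t /qP ->; rewrite !(addrC n%:R) !addrK.
elim: m => [|m [q qP]].
  by exists 1 => t _; rewrite derive1n0 hornerC mulr1 !subr0.
exists (deriv q * ((1 - 'X) * (1 + 'X))
  + q * ((n%:R + beta - m%:R) *: (1 - 'X) - (n%:R + alpha - m%:R) *: (1 + 'X))).
move=> t t11; rewrite -natr1 !opprD !addrA -derive1_powR_poly//.
rewrite derive1nS !derive1E; apply: near_eq_derive.
have /andP[t1 t2] := t11.
near=> s; apply: qP; apply/andP; split; near: s.
- exact: lt_nbhsr.
- exact: lt_nbhsl.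
Unshelve. all: end_near. Qed.

(* P_(k, n)^(alpha, beta, gamma); meant for k <= n. The polynomial of the
   literature and this expression agree wherever l2 + l3 <> 0, and also at
   l2 = l3 = 0, since (l2 + l3) ^+ k = 0 there when k > 0 and jacobi 0 is a
   constant; hence they agree on the whole triangle. *)
Definition jacobi_triangle (R : realType) (k n : nat) (alpha beta gamma : R)
    (l1 l2 l3 : R) : R :=
  (l2 + l3) ^+ k
  * (jacobi (n - k) (2 * k%:R + beta + gamma + 1) alpha).[l1 - l2 - l3]
  * (jacobi k gamma beta).[(l2 - l3) / (l2 + l3)].

Definition cross (R : realType) (p q s : R * R) : R :=
  (q.1 - p.1) * (s.2 - p.2) - (s.1 - p.1) * (q.2 - p.2).

Record triangle (R : realType) := Triangle {
  vtx1 : R * R;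
  vtx2 : R * R;
  vtx3 : R * R;
  vtx_noncollinear : cross vtx1 vtx2 vtx3 != 0 }.

Section triangle_theory.
Variables (R : realType) (K : triangle R).
Implicit Types (x : R * R) (v : R * R -> R) (m : int).

Definition triangle_set : set (R * R) :=
  [set x | exists t1 t2 t3 : R,
    [/\ 0 <= t1, 0 <= t2, 0 <= t3, t1 + t2 + t3 = 1 &
      x = (t1 * (vtx1 K).1 + t2 * (vtx2 K).1 + t3 * (vtx3 K).1,
           t1 * (vtx1 K).2 + t2 * (vtx2 K).2 + t3 * (vtx3 K).2)]].

Definition bary1 x := cross x (vtx2 K) (vtx3 K) / cross (vtx1 K) (vtx2 K) (vtx3 K).
Definition bary2 x := cross (vtx1 K) x (vtx3 K) / cross (vtx1 K) (vtx2 K) (vtx3 K).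
Definition bary3 x := cross (vtx1 K) (vtx2 K) x / cross (vtx1 K) (vtx2 K) (vtx3 K).

Lemma baryP x (t1 t2 t3 : R) :
  (t1 = bary1 x /\ t2 = bary2 x /\ t3 = bary3 x) <->
  (t1 + t2 + t3 = 1 /\
   x = (t1 * (vtx1 K).1 + t2 * (vtx2 K).1 + t3 * (vtx3 K).1,
        t1 * (vtx1 K).2 + t2 * (vtx2 K).2 + t3 * (vtx3 K).2)).
Proof.
have := vtx_noncollinear K; rewrite /bary1 /bary2 /bary3 /cross.
case: x (vtx1 K) (vtx2 K) (vtx3 K) => x y [a1 b1] [a2 b2] [a3 b3] /= d0.
split=> [[-> [-> ->]]|[t1E [-> ->]]].
  split; first by field.
  by apply/pair_equal_spec; split; field.
have -> : t3 = 1 - t1 - t2 by lra.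
by split; [|split]; field.
Qed.

Definition bubble x : R := bary1 x * bary2 x * bary3 x.

Definition plane_measure := (@lebesgue_measure R \x @lebesgue_measure R)%E.

Definition triangle_area : R := fine (plane_measure triangle_set).

Definition triangle_int v : R := \int[plane_measure]_(x in triangle_set) v x.

(* Functions on the triangle are represented by functions on the plane whose
   values outside the triangle are irrelevant: membership in the spaces below,
   as well as linear relations, only involve values on the triangle. *)
Definition Ppoly m : set (R * R -> R) :=
  match m with
  | Posz d => [set v | exists c : nat -> nat -> R,
      forall x, triangle_set x ->
        v x = \sum_(i < d.+1) \sum_(j < d.+1 | (i + j <= d)%N)
                c i j * x.1 ^+ i * x.2 ^+ j]
  | Negz _ => [set v | forall x, triangle_set x -> v x = 0]
  end.

Definition Rpoly m : set (R * R -> R) :=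
  [set v | Ppoly m v /\
    forall q, Ppoly (m - 1) q ->
      triangle_int (fun x => bubble x ^+ 2 * v x * q x) = 0].

Definition bubble_space m : set (R * R -> R) :=
  [set v | exists2 w, Rpoly m w &
    forall x, triangle_set x -> v x = bubble x ^+ 2 * w x].

Definition is_basis (V : set (R * R -> R)) (n : nat)
    (phi : 'I_n -> R * R -> R) :=
  [/\ forall k, V (phi k),
      forall c : 'I_n -> R,
        (forall x, triangle_set x -> \sum_k c k * phi k x = 0) ->
        forall k, c k = 0 &
      forall v, V v -> exists c : 'I_n -> R,
        forall x, triangle_set x -> v x = \sum_k c k * phi k x].

Definition is_shape_functions (V : set (R * R -> R)) (n : nat)
    (dof : 'I_n -> (R * R -> R) -> R) (phi : 'I_n -> R * R -> R) :=
  is_basis V phi /\ forall j k, dof j (phi k) = (j == k)%:R.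

Definition jacobi_K (k n : nat) x : R :=
  jacobi_triangle k n 2 2 2 (bary1 x) (bary2 x) (bary3 x).

Definition bubble_dof (r k : nat) v : R :=
  triangle_area^-1 * triangle_int (fun x => v x * jacobi_K k (r - 2) x).

End triangle_theory.

(* a_(k, r - 2) as a function of r and k *)
Definition bubble_coef (R : realType) (r k : nat) : R :=
  let r' : R := r%:R in let k' : R := k%:R in
  ((2 * r' + 4) * (2 * k' + 5) * (r' + k' + 4) * (r' + k' + 5)
    * (k' + 3) * (k' + 4))
  / (2 * (r' - k') * (r' - 1 - k') * (k' + 1) * (k' + 2)).

(* Main.v *)
From HB Require Import structures.
Require Import Defs.
From mathcomp Require Import all_boot all_order all_algebra.
From mathcomp Require Import all_classical all_reals all_analysis.
From mathcomp Require Import measurable_realfun zify ring lra.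
Import Order.TTheory GRing.Theory Num.Theory.
Import numFieldNormedType.Exports.
Set Implicit Arguments.
Unset Strict Implicit.
Unset Printing Implicit Defensive.
Local Open Scope classical_set_scope.
Local Open Scope ring_scope.

(** Everything rests on the fact that the polynomials P_(k,m)^(2,2,2), with
    k <= m, are orthogonal on K for the weight b_K^2.  To see this, pull
    integrals over K back to the square [-1, 1]^2 by the collapsed (Duffy)
    coordinates
      l1 = (1 + s) / 2,  l2 = (1 - s) (1 + t) / 4,  l3 = (1 - s) (1 - t) / 4.
    There l1 - l2 - l3 = s, (l2 - l3) / (l2 + l3) = t and the Jacobian is
    proportional to 1 - s, so b_K^2 P_(k,m) P_(k',m') becomes a product of a
    function of s and a function of t (triangle_int_chart).  The t-integral is
    the orthogonality relation of the P_k^(2,2); for k = k' the s-integral is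
    that of the P_(m-k)^(2k+5,2), the exponent 2k + 5 collecting the factors
    (1 - s) from b_K^2 (four), from the two P_(k,.) (2k) and from the Jacobian
    (one).  The one-dimensional relations and norms (jacobi_orthogonal,
    jacobi_norm) follow from Rodrigues' formula by repeated integration by
    parts and the Beta integral.  Multiplying the two norms, with the powers of
    2 from the change of variables, gives |K| / a_(k,m) (bubble_coef_sqnorm).

    The P_(k,m) with m <= n moreover span the polynomials of degree at most n
    (Ppoly_sub_span_tjacobi): in the variables l2 - l3 and l2 + l3 they are
    triangular with respect to the monomials.  Expanding in this orthogonal
    basis, a polynomial of degree at most n is orthogonal to all polynomials of
    degree less than n exactly when its coefficients on the P_(k,m), m < n,
    vanish; hence the P_(k,n) form a basis of R^n(K), and duality with the
    degrees of freedom is the orthogonality relation once more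
    (shape_functions).

    The change of variables is obtained from Tonelli's theorem and affine
    substitutions in one variable: the collapsed coordinates factor into maps
    that move the points of each vertical, or of each horizontal, line affinely
    within that line. *)

(** * Affine substitution on the line *)

Section line.
Context {R : realType}.
Local Notation mu := (@lebesgue_measure R).

Lemma measurable_affine (a b : R) :
  measurable_fun setT (fun y : measurableTypeR R => a * y + b : measurableTypeR R).
Proof.
by apply: measurable_funD => //; apply: measurable_funM.
Qed.

(** Both sides are measures, and they agree on half-open intervals; the sign of
    [a] decides which end of the preimage is closed. *)
Lemma lebesgue_measure_affine (a b : R) (A : set (measurableTypeR R)) :
  a != 0 -> measurable A ->
  (`|a|%:E * pushforward mu
    (fun y : measurableTypeR R => (a * y + b)%R : measurableTypeR R) A = mu A)%E.
Proof.
move=> a0 mA.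
pose phi := (fun y : measurableTypeR R => a * y + b : measurableTypeR R).
have mphi : measurable_fun setT phi by exact: measurable_affine.
have @nu : {measure set (measurableTypeR R) -> \bar R}.
  by refine (mscale (NngNum (normr_ge0 a)) (pushforward mu phi)); exact: mphi.
suff -> : mu A = nu A by [].
apply: lebesgue_measure_unique => // _ [[c d]] _ <-.
rewrite /nu /= /mscale /= /pushforward.
have -> : phi @^-1` [set x | x \in `]c, d]] =
   if 0 < a then [set` `](c - b) / a, (d - b) / a] ] else [set` `[(d - b) / a, (c - b) / a[ ].
  apply/seteqP; rewrite /phi/= /phi/=; case: ltP => a1; split=> y /=;
    rewrite !in_itv /=.
  - by rewrite ltr_pdivrMr// ler_pdivlMr//; lra.
  - by rewrite ltr_pdivrMr// ler_pdivlMr//; lra.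
  - have a2 : a < 0 by rewrite lt_neqAle a0.
    by rewrite ltr_ndivlMr// ler_ndivrMr//; lra.
  - have a2 : a < 0 by rewrite lt_neqAle a0.
    by rewrite ltr_ndivlMr// ler_ndivrMr//; lra.
rewrite lebesgue_measure_itv/= lte_fin.
case: (ltP 0 a) => [a1|a1']; [|have {a1'} a1 : a < 0 by rewrite lt_neqAle a0];
  rewrite lebesgue_measure_itv/= lte_fin.
  rewrite ltr_pM2r ?invr_gt0// ltrD2r; case: ifP => _; rewrite ?mule0//.
  by rewrite -!EFinB -EFinM gtr0_norm//; congr EFin; field.
rewrite ltr_nM2r ?invr_lt0// ltrD2r; case: ifP => _; rewrite ?mule0//.
by rewrite -!EFinB -EFinM ltr0_norm//; congr EFin; field.
Qed.

Lemma ge0_integral_affine (a b : R) (f : R -> \bar R) : a != 0 ->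
  measurable_fun setT f -> (forall y, 0 <= f y)%E ->
  (\int[mu]_y f y = \int[mu]_y (`|a|%:E * f (a * y + b)%R))%E.
Proof.
move=> a0 mf f0.
pose phi := (fun y : measurableTypeR R => a * y + b : measurableTypeR R).
have mphi : measurable_fun setT phi by exact: measurable_affine.
have @nu : {measure set (measurableTypeR R) -> \bar R}.
  by refine (mscale (NngNum (normr_ge0 a)) (pushforward mu phi)); exact: mphi.
transitivity (\int[nu]_y f y)%E.
  by apply: eq_measure_integral => A mA _; exact/esym/lebesgue_measure_affine.
rewrite ge0_integral_mscale//= ge0_integral_pushforward// ge0_integralZl//.
exact: measurableT_comp.
Qed.

End line.

(** * Integrating over slices of the plane *)

Section plane.
Context {R : realType}.
Local Notation mu := (@lebesgue_measure R).
Local Notation plane := (@plane_measure R).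
Local Notation RR := (measurableTypeR R * measurableTypeR R)%type.

Lemma measurable_comp_weighted (F : RR -> \bar R) (h g1 g2 : RR -> measurableTypeR R) :
  measurable_fun setT F -> measurable_fun setT h -> measurable_fun setT g1 ->
  measurable_fun setT g2 ->
  measurable_fun setT (fun z => (h z)%:E * F (g1 z, g2 z))%E.
Proof.
move=> mF mh mg1 mg2; apply: emeasurable_funM; first exact/measurable_EFinP.
by apply: (measurableT_comp mF); exact: measurable_fun_pair.
Qed.

Lemma ge0_integral_swap (F : RR -> \bar R) : measurable_fun setT F ->
  (forall z, 0 <= F z)%E ->
  (\int[plane]_z F z = \int[plane]_z F (z.2, z.1))%E.
Proof.
move=> mF F0; rewrite [LHS]fubini_tonelli1// [RHS]fubini_tonelli2//.
by apply: measurableT_comp => //; apply: measurable_fun_pair.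
Qed.

(** The substitution [y := a x * y' + b x] is done inside Tonelli's iterated
    integral, one vertical line at a time, so [a] and [b] may depend on [x].
    Lines with [a x = 0] are collapsed to a point and must not contribute:
    this happens at the vertex where the collapsed coordinates degenerate. *)
Lemma ge0_integral_slices (F : RR -> \bar R) (a b : R -> R) :
  measurable_fun setT F -> (forall z, 0 <= F z)%E ->
  measurable_fun setT a -> measurable_fun setT b ->
  (forall x, a x = 0 -> (\int[mu]_y F (x, y) = 0)%E) ->
  (\int[plane]_z F z =
   \int[plane]_z (`|a z.1|%:E * F (z.1, a z.1 * z.2 + b z.1)%R))%E.
Proof.
move=> mF F0 ma mb aF.
have ma1 : measurable_fun setT (fun z : RR => a z.1 : measurableTypeR R).
  exact: (measurableT_comp ma).
have mb1 : measurable_fun setT (fun z : RR => b z.1 : measurableTypeR R).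
  exact: (measurableT_comp mb).
rewrite [LHS]fubini_tonelli1// [RHS]fubini_tonelli1//; last 2 first.
- apply: measurable_comp_weighted => //.
    exact: (measurableT_comp (@normr_measurable _ _)).
  by apply: measurable_funD => //; apply: measurable_funM.
- by move=> z; rewrite mule_ge0.
apply: eq_integral => x _; rewrite /fubini_F.
have [ax0|ax0] := eqVneq (a x) 0.
  by rewrite aF//= integral0_eq// => y _; rewrite ax0 normr0 mul0e.
rewrite (ge0_integral_affine (b x) ax0)//.
exact: (measurableT_comp mF (measurable_pair1 _)).
Qed.

Lemma ge0_integral_slices2 (F : RR -> \bar R) (a b : R -> R) :
  measurable_fun setT F -> (forall z, 0 <= F z)%E ->
  measurable_fun setT a -> measurable_fun setT b ->
  (forall y, a y != 0) ->
  (\int[plane]_z F z =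
   \int[plane]_z (`|a z.2|%:E * F (a z.2 * z.1 + b z.2, z.2)%R))%E.
Proof.
move=> mF F0 ma mb a0.
have ma1 : measurable_fun setT (fun z : RR => a z.1 : measurableTypeR R).
  exact: (measurableT_comp ma).
have mb1 : measurable_fun setT (fun z : RR => b z.1 : measurableTypeR R).
  exact: (measurableT_comp mb).
rewrite ge0_integral_swap// (@ge0_integral_slices _ a b)//; last 2 first.
- by apply: (measurableT_comp mF); exact: measurable_fun_pair.
- by move=> x ax0; have := a0 x; rewrite ax0 eqxx.
rewrite [LHS]ge0_integral_swap//=.
- apply: (@measurable_comp_weighted F) => //.
    exact: (measurableT_comp (@normr_measurable _ _)).
  by apply: measurable_funD => //; apply: measurable_funM.
- by move=> z; rewrite mule_ge0.
Qed.

Lemma integral_product (g h : R -> R) :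
  mu.-integrable setT (EFin \o g) -> mu.-integrable setT (EFin \o h) ->
  plane.-integrable setT (fun z => (g z.1 * h z.2)%:E) /\
  (\int[plane]_z (g z.1 * h z.2)%:E =
   (\int[mu]_x g x * \int[mu]_x h x)%R%:E)%E.
Proof.
move=> ig ih.
have mg := measurable_int _ ig; have mh := measurable_int _ ih.
have mgh : measurable_fun setT (fun z : RR => (g z.1 * h z.2)%:E).
  apply/measurable_EFinP; apply: measurable_funM.
    by apply: measurableT_comp => //; exact/measurable_EFinP.
  by apply: measurableT_comp => //; exact/measurable_EFinP.
have igh : plane.-integrable setT (fun z : RR => (g z.1 * h z.2)%:E).
  apply/integrable12ltyP => //.
  have : (\int[mu]_x (`|(g x)%:E| * \int[mu]_y `|(h y)%:E|) < +oo)%E.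
    rewrite ge0_integralZr//; last 2 first.
    - exact: measurableT_comp.
    - exact: integral_ge0.
    apply: lte_mul_pinfty; first exact: integral_ge0.
      by rewrite ge0_fin_numE ?integral_ge0//; case/integrableP : ig.
    by case/integrableP : ih.
  apply: le_lt_trans; rewrite le_eqVlt; apply/orP; left; apply/eqP.
  apply: eq_integral => x _; rewrite -ge0_integralZl//; last exact: measurableT_comp.
  by apply: eq_integral => y _; rewrite -abseM.
split=> //; rewrite -[LHS]integral12_prod_meas1//.
have fg := integrable_fin_num measurableT ig.
have fh := integrable_fin_num measurableT ih.
transitivity (\int[mu]_x ((g x)%:E * (\int[mu]_y h y)%R%:E))%E.
  apply: eq_integral => x _; rewrite /fubini_F /=.
  by under eq_integral do rewrite EFinM; rewrite integralZl// /Rintegral fineK.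
by rewrite integralZr// EFinM /Rintegral [in RHS]fineK.
Qed.

End plane.

(** * Collapsed coordinates on a triangle *)

(** The collapsed coordinates: the side [z.1 = 1] of the square is mapped to the
    first vertex, and the rest of the square bijectively to the rest of the
    triangle. *)
Definition chart (R : realType) (K : triangle R) (z : R * R) : R * R :=
  let l1 := (1 + z.1) / 2 in
  let l2 := (1 - z.1) * (1 + z.2) / 4 in
  let l3 := (1 - z.1) * (1 - z.2) / 4 in
  (l1 * (vtx1 K).1 + l2 * (vtx2 K).1 + l3 * (vtx3 K).1,
   l1 * (vtx1 K).2 + l2 * (vtx2 K).2 + l3 * (vtx3 K).2).

Section triangle.
Context {R : realType}.
Local Notation mu := (@lebesgue_measure R).
Local Notation plane := (@plane_measure R).
Local Notation RR := (measurableTypeR R * measurableTypeR R)%type.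
Implicit Types K : triangle R.

(** The Jacobian of [chart K] at [z] is [chart_scale K * `|1 - z.1|]. *)
Definition chart_scale K := `|cross (vtx1 K) (vtx2 K) (vtx3 K)| / 8.

Lemma triangle_setE K x :
  triangle_set K x <-> [/\ 0 <= bary1 K x, 0 <= bary2 K x & 0 <= bary3 K x].
Proof.
split=> [[t1 [t2 [t3 [h1 h2 h3 s xE]]]]|[h1 h2 h3]].
  by have [_ /(_ (conj s xE))[<- [<- <-]]] := baryP K x t1 t2 t3.
have [/(_ (conj erefl (conj erefl erefl)))[s xE] _] :=
  baryP K x (bary1 K x) (bary2 K x) (bary3 K x).
by exists (bary1 K x), (bary2 K x), (bary3 K x).
Qed.

Lemma bary_chart K z :
  [/\ bary1 K (chart K z) = (1 + z.1) / 2,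
      bary2 K (chart K z) = (1 - z.1) * (1 + z.2) / 4 &
      bary3 K (chart K z) = (1 - z.1) * (1 - z.2) / 4].
Proof.
have [_ []] := baryP K (chart K z) ((1 + z.1) / 2)
  ((1 - z.1) * (1 + z.2) / 4) ((1 - z.1) * (1 - z.2) / 4).
  by split=> //; field.
by move=> <- [<- <-].
Qed.

Lemma chart_triangle K z : z.1 != 1 ->
  triangle_set K (chart K z) <-> (-1 <= z.1 <= 1 /\ -1 <= z.2 <= 1).
Proof.
move=> z1; rewrite triangle_setE; have [-> -> ->] := bary_chart K z.
split=> [[h1 h2 h3]|[/andP[h1 h2] /andP[h3 h4]]].
  have s1 : -1 <= z.1 by lra.
  have s2 : z.1 < 1.
    rewrite lt_neqAle z1 leNgt; apply/negP => h.
    by have : (1 - z.1) * (1 + z.2) + (1 - z.1) * (1 - z.2) < 0; [nra|lra].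
  have s3 : 0 < 1 - z.1 by lra.
  rewrite s1 (ltW s2); split=> //; apply/andP; split.
    have : 0 <= (1 - z.1) * (1 + z.2) by lra.
    by rewrite pmulr_rge0//; lra.
  have : 0 <= (1 - z.1) * (1 - z.2) by lra.
  by rewrite pmulr_rge0//; lra.
split; first by lra.
  by rewrite divr_ge0// mulr_ge0//; lra.
by rewrite divr_ge0// mulr_ge0//; lra.
Qed.

Ltac measurable_step := repeat first [ exact: measurable_cst | exact: measurable_fst
  | exact: measurable_snd | exact: measurable_id
  | apply: measurable_funD | apply: measurable_funN | apply: measurable_funM
  | apply: measurable_fun_pair
  | apply: (measurableT_comp (@normr_measurable _ _)) ].

Ltac emeasurable_step mF := rewrite /=; repeat first [ apply: emeasurable_funM
  | apply/measurable_EFinP; measurable_step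
  | apply: (measurableT_comp mF); measurable_step ].

Lemma measurable_bary K :
  [/\ measurable_fun setT (bary1 K : RR -> measurableTypeR R),
      measurable_fun setT (bary2 K : RR -> measurableTypeR R) &
      measurable_fun setT (bary3 K : RR -> measurableTypeR R)].
Proof. by split; rewrite /bary1 /bary2 /bary3 /cross /=; measurable_step. Qed.

Lemma measurable_triangle K : measurable (triangle_set K : set RR).
Proof.
have [m1 m2 m3] := measurable_bary K.
have -> : triangle_set K = (setT `&` bary1 K @^-1` `[0, +oo[) `&`
  (setT `&` bary2 K @^-1` `[0, +oo[) `&` (setT `&` bary3 K @^-1` `[0, +oo[).
  apply/seteqP; split=> x; rewrite /= !in_itv/= !andbT.
    by move/triangle_setE => -[].
  by move=> [[[_ ?] [_ ?]] [_ ?]]; exact/triangle_setE.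
by apply: measurableI; [apply: measurableI|];
  [apply: m1|apply: m2|apply: m3] => //; exact: measurable_itv.
Qed.

(** The map [chart K] is factored into four slice substitutions: the shear
    y = b3 + p (x - a3) + q v along vertical lines, then x in terms of the
    barycentric coordinate u at fixed v, then v = (1 - u) (1 + t) / 2, then
    u = (1 + s) / 2.  The first one needs the side from vertex 1 to vertex 3
    not to be vertical, as p is its slope. *)
Lemma ge0_integral_chart_nonvertical K (F : RR -> \bar R) :
  (vtx1 K).1 != (vtx3 K).1 ->
  measurable_fun setT F -> (forall z, 0 <= F z)%E ->
  (forall x, ~ triangle_set K x -> F x = 0%E) ->
  (\int[plane]_z F z = \int[plane]_z ((chart_scale K * `|1 - z.1|)%:E * F (chart K z)))%E.
Proof.
move=> V13 mF F0 FK.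
set a1 := (vtx1 K).1 in V13 *; set b1 := (vtx1 K).2.
set a2 := (vtx2 K).1; set b2 := (vtx2 K).2.
set a3 := (vtx3 K).1 in V13 *; set b3 := (vtx3 K).2.
have a13 : a1 - a3 != 0 by rewrite subr_eq0.
pose d := cross (vtx1 K) (vtx2 K) (vtx3 K).
have d0 : d != 0 by exact: vtx_noncollinear.
pose q := d / (a1 - a3).
have q0 : q != 0 by rewrite mulf_neq0// invr_neq0.
pose p := (b1 - b3) / (a1 - a3).
rewrite (@ge0_integral_slices _ F (cst q) (fun x => b3 + p * (x - a3)))//;
  [|by measurable_step|by move=> ? /eqP; rewrite (negbTE q0)].
rewrite (@ge0_integral_slices2 _ _ (cst (a1 - a3)) (fun v => a3 + (a2 - a3) * v))//;
  [|by emeasurable_step mF|by move=> z; rewrite !mule_ge0|by measurable_step].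
pose h (u : R) := (1 - u) / 2.
have mh : measurable_fun setT h by rewrite /h; measurable_step.
rewrite (@ge0_integral_slices _ _ h h)//; last 3 first.
- by emeasurable_step mF.
- by move=> z; rewrite !mule_ge0.
- (* On the line u = 1 the triangle has the single point v = 0. *)
  move=> u /eqP; rewrite mulf_eq0 invr_eq0 pnatr_eq0 orbF subr_eq0 => /eqP <-{u}.
  rewrite -(@integral_set1 R (fun v => (`|a1 - a3|%:E * (`|q|%:E * F
   (((a1 - a3) * 1 + (a3 + (a2 - a3) * v))%R,
    (q * v + (b3 + p * ((a1 - a3) * 1 + (a3 + (a2 - a3) * v) - a3)))%R)))%E) 0).
  rewrite [RHS]integral_mkcond; apply: eq_integral => v _; rewrite patchE.
  case: ifPn => //; rewrite notin_setE/= => v0.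
  rewrite FK ?mule0// triangle_setE.
  set x := (X in bary1 K X).
  have [_ []] := baryP K x 1 v (- v).
    split; first by lra.
    rewrite /x -/a1 -/a2 -/a3 -/b1 -/b2 -/b3 /q /d /p /cross -/a1 -/a2 -/a3 -/b1 -/b2 -/b3.
    by apply/pair_equal_spec; split; field.
  by move=> _ [<- <-] [_ v1 v2]; apply: v0; lra.
rewrite (@ge0_integral_slices2 _ _ (cst (1/2)) (cst (1/2)))//; last 3 first.
- by rewrite /h; emeasurable_step mF.
- by move=> z; rewrite !mule_ge0.
- by move=> z; rewrite /cst mulf_neq0.
apply: eq_integral => z _ /=.
rewrite !muleA -!EFinM; congr (_ %:E * F _)%E.
  rewrite /chart_scale -/d -!normrM -[8]gtr0_norm// -normfV -!normrM; congr `| _ |.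
  by rewrite /q /h; field.
rewrite /chart /h -/a1 -/a2 -/a3 -/b1 -/b2 -/b3 /q /d /p /cross -/a1 -/a2 -/a3 -/b1 -/b2 -/b3.
by apply/pair_equal_spec; split; field.
Qed.

(** A nondegenerate triangle with a vertical side from vertex 1 to vertex 3
    loses it when the two coordinates are exchanged, which preserves the
    measure and all barycentric coordinates. *)
Lemma ge0_integral_plane_chart K (F : RR -> \bar R) :
  measurable_fun setT F -> (forall z, 0 <= F z)%E ->
  (forall x, ~ triangle_set K x -> F x = 0%E) ->
  (\int[plane]_z F z = \int[plane]_z ((chart_scale K * `|1 - z.1|)%:E * F (chart K z)))%E.
Proof.
move=> mF F0 FK.
have [V13|V13] := eqVneq (vtx1 K).1 (vtx3 K).1; last
  exact: ge0_integral_chart_nonvertical.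
pose sw (x : R * R) := (x.2, x.1).
have crossS p q s : cross (sw p) (sw q) (sw s) = - cross p q s.
  by rewrite /cross /=; ring.
have nc : cross (sw (vtx1 K)) (sw (vtx2 K)) (sw (vtx3 K)) != 0.
  by rewrite crossS oppr_eq0; exact: vtx_noncollinear.
pose K' := Triangle nc.
have K'E x : triangle_set K' x <-> triangle_set K (sw x).
  have E (u : R) (v : R) : - u / - v = u / v by rewrite invrN mulrNN.
  have xE : x = sw (sw x) by case: x.
  rewrite !triangle_setE /bary1 /bary2 /bary3 [in X in X <-> _]xE /=.
  rewrite -/(sw _) -/(sw _) -/(sw _).
  by rewrite !crossS !E.
rewrite ge0_integral_swap// (@ge0_integral_chart_nonvertical K' (fun z => F (z.2, z.1)))//.
- apply: eq_integral => z _ /=; congr (_ * F _)%E.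
  by rewrite /chart_scale crossS normrN.
- apply/eqP => /= V13'; have := vtx_noncollinear K.
  by rewrite /cross V13 V13' !subrr !(mul0r, mulr0) subrr eqxx.
- by apply: (measurableT_comp mF); measurable_step.
- by move=> x xK'; apply: FK => xK; apply: xK'; apply/K'E.
Qed.

(** The weight is nonnegative, so it commutes with taking positive and negative
    parts; this reduces to the nonnegative case without any integrability
    assumption. *)
Lemma integral_plane_chart K (F : RR -> \bar R) :
  measurable_fun setT F -> (forall x, ~ triangle_set K x -> F x = 0%E) ->
  (\int[plane]_z F z = \int[plane]_z ((chart_scale K * `|1 - z.1|)%:E * F (chart K z)))%E.
Proof.
move=> mF FK; rewrite integralE [RHS]integralE; congr (_ - _)%E.
  rewrite (@ge0_integral_plane_chart K)//.
  - apply: eq_integral => z _; rewrite !funeposE maxeMr ?mule0//.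
    by rewrite lee_fin mulr_ge0// /chart_scale divr_ge0.
  - exact: measurable_funepos.
  - by move=> x xK; rewrite funeposE FK// maxxx.
rewrite (@ge0_integral_plane_chart K)//.
- apply: eq_integral => z _; rewrite !funenegE maxeMr ?mule0 ?muleN//.
  by rewrite lee_fin mulr_ge0// /chart_scale divr_ge0.
- exact: measurable_funeneg.
- by move=> x xK; rewrite funenegE FK// oppe0 maxxx.
Qed.

Definition poly_int (p : {poly R}) : R := \int[mu]_(t in `[-1, 1]) p.[t].

Lemma integrable_poly (p : {poly R}) : mu.-integrable `[-1, 1] (EFin \o horner p).
Proof.
apply: continuous_compact_integrable; first exact: segment_compact.
exact/continuous_subspaceT/continuous_horner.
Qed.

(** The form in which integrals over the triangle are evaluated.  Integrability
    comes for free: after the change of variables the integrand is a finite sum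
    of products of one-variable functions that are integrable on [-1, 1]. *)
Lemma triangle_int_chart K (f : R * R -> R) (T : finType) (A B : T -> {poly R}) :
  measurable_fun (triangle_set K : set RR) f ->
  (forall s t, -1 <= s <= 1 -> -1 <= t <= 1 ->
     f (chart K (s, t)) = \sum_i (A i).[s] * (B i).[t]) ->
  triangle_int K f = chart_scale K * \sum_i poly_int ((1 - 'X) * A i) * poly_int (B i).
Proof.
move=> mf fE.
pose g i : R -> R := horner (chart_scale K *: ((1 - 'X) * A i)) \_ `[-1, 1].
pose h i : R -> R := horner (B i) \_ `[-1, 1].
have ig (p : {poly R}) : mu.-integrable setT (EFin \o (horner p \_ `[-1, 1])).
  rewrite -restrict_EFin; apply: (integrable_mkcond _ _).1 => //.
  exact: integrable_poly.
have int (p : {poly R}) : \int[mu]_x (horner p \_ `[-1, 1]) x = poly_int p.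
  by rewrite -Rintegral_mkcond.
rewrite /triangle_int /Rintegral integral_mkcond.
have mK := measurable_triangle K.
rewrite (@integral_plane_chart K); last 2 first.
- by apply/(measurable_restrictT _ mK); exact/measurable_EFinP.
- by move=> x xK; rewrite patchE memNset.
transitivity (fine (\int[plane]_z (\sum_i (g i z.1 * h i z.2)%:E)%E)).
  congr fine; apply: eq_integral => -[s t] _; rewrite sumEFin /= /g /h.
  (* At s = 1 the chart stays at a vertex for every t, but the weight vanishes. *)
  have [-> |s1] := eqVneq s 1.
    rewrite subrr normr0 mulr0 mul0e big1// => i _; rewrite patchE.
    case: ifP => _; last by rewrite mul0r.
    by rewrite hornerZ hornerM hornerD hornerN hornerX hornerC subrr mul0r mulr0 mul0r.
  rewrite patchE; case: ifPn => [|] stK.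
    have {stK} [/= s11 t11] := (@chart_triangle K (s, t) s1).1 (set_mem stK).
    rewrite -EFinM; congr EFin; rewrite fE// mulr_sumr; apply: eq_bigr => i _.
    rewrite !patchE !mem_set/= ?in_itv//= hornerZ hornerM hornerD hornerN hornerX hornerC.
    by rewrite ger0_norm ?subr_ge0 ?(andP s11).2//; ring.
  rewrite mule0 big1// => i _; rewrite !patchE.
  case: ifPn => [|_]; last by rewrite mul0r.
  case: ifPn => [|_]; last by rewrite mulr0.
  rewrite !inE/= !in_itv/= => t11 s11.
  by move: stK; rewrite notin_setE => -[]; apply/(@chart_triangle K (s, t) s1).
rewrite integral_sum//; last by move=> i; apply: (integral_product (ig _) (ig _)).1.
rewrite mulr_sumr.
under eq_bigr do rewrite (integral_product (ig _) (ig _)).2 !int.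
rewrite sumEFin /=; apply: eq_bigr => i _.
rewrite mulrA; congr (_ * _); rewrite /poly_int -RintegralZl//; last exact: integrable_poly.
by apply: eq_Rintegral => t _; rewrite hornerZ.
Qed.

End triangle.

(** * Integrals of polynomials over [-1, 1] *)

Section poly_int.
Context {R : realType}.
Implicit Types p q u : {poly R}.
Local Notation mu := (@lebesgue_measure R).

Lemma poly_int_is_linear : linear_for *%R (@poly_int R : {poly R} -> R).
Proof.
move=> c p q; rewrite /poly_int -RintegralZl//; last exact: integrable_poly.
rewrite -RintegralD//; first by apply: eq_Rintegral => t _; rewrite hornerD hornerZ.
  have -> : EFin \o (fun t : R => c * p.[t]) = EFin \o horner (c *: p).
    by apply/funext => t /=; rewrite hornerZ.
  exact: integrable_poly.
exact: integrable_poly.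
Qed.

HB.instance Definition _ :=
  GRing.isLinear.Build R {poly R} R *%R (@poly_int R) poly_int_is_linear.

Lemma poly_int_deriv p : poly_int (deriv p) = p.[1] - p.[-1].
Proof.
rewrite /poly_int /Rintegral (@continuous_FTC2 R (horner (deriv p)) (horner p)) //; last first.
- by move=> x _; rewrite derive1E; have [_ ->] := is_derive_poly p x.
- split=> [x _||]; first by have [] := is_derive_poly p x.
    by apply: cvg_at_right_filter; exact: continuous_horner.
  by apply: cvg_at_left_filter; exact: continuous_horner.
- exact/continuous_subspaceT/continuous_horner.
Qed.

Lemma poly_int_parts p q : p.[1] = 0 -> p.[-1] = 0 ->
  poly_int (deriv p * q) = - poly_int (p * deriv q).
Proof.
move=> p1 pN1; apply/eqP; rewrite -addr_eq0 -raddfD/= -derivM poly_int_deriv.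
by rewrite !hornerM p1 pN1 !mul0r subrr.
Qed.

Definition jacobi_weight (a b : nat) : {poly R} := (1 - 'X) ^+ a * (1 + 'X) ^+ b.

Lemma horner_1BX t : (1 - 'X : {poly R}).[t] = 1 - t.
Proof. by rewrite hornerD hornerN hornerX hornerC. Qed.

Lemma horner_1DX t : (1 + 'X : {poly R}).[t] = 1 + t.
Proof. by rewrite hornerD hornerX hornerC. Qed.

Lemma deriv_1BXn n : deriv ((1 - 'X) ^+ n.+1) = - ((1 - 'X) ^+ n *+ n.+1) :> {poly R}.
Proof. by rewrite deriv_exp derivB derivX derivC sub0r mulN1r mulNrn. Qed.

Lemma deriv_1DXn n : deriv ((1 + 'X) ^+ n.+1) = (1 + 'X) ^+ n *+ n.+1 :> {poly R}.
Proof. by rewrite deriv_exp derivD derivX derivC add0r mul1r. Qed.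

(** The Beta integral.  Differentiating [jacobi_weight a.+1 b.+1], which vanishes
    at both ends, trades a factor 1 + t for a factor 1 - t. *)
Lemma poly_int_jacobi_weight (a b : nat) :
  poly_int (jacobi_weight a b) = 2 ^+ (a + b).+1 * a`!%:R * b`!%:R / (a + b).+1`!%:R.
Proof.
have fN0 n : n`!%:R != 0 :> R by rewrite pnatr_eq0 -lt0n fact_gt0.
elim: b a => [|b IHb] a.
  have := poly_int_deriv ((1 - 'X) ^+ a.+1 : {poly R}).
  rewrite deriv_1BXn raddfN raddfMn/= /jacobi_weight expr0 mulr1 => h.
  have {h} : poly_int ((1 - 'X) ^+ a : {poly R}) *+ a.+1 = 2 ^+ a.+1.
    rewrite -[LHS]opprK h !horner_exp !horner_1BX.
    by rewrite subrr expr0n/= sub0r !opprK.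
  rewrite addn0 factS natrM fact0 => <-; rewrite -mulr_natr mulr1; field.
  by rewrite fN0/= addrC natr1 pnatr_eq0.
have := poly_int_deriv (jacobi_weight a.+1 b.+1).
rewrite /jacobi_weight derivM deriv_1BXn deriv_1DXn !hornerM !horner_exp.
rewrite !horner_1BX !horner_1DX.
rewrite !subrr !expr0n/= mul0r mulr0 subrr mulNr mulrnAl mulrnAr.
rewrite raddfD raddfN !raddfMn/= -!/(jacobi_weight _ _) IHb => /eqP.
rewrite mulNrn addrC subr_eq0 => /eqP h.
have a0 : a.+1%:R != 0 :> R by rewrite pnatr_eq0.
apply: (mulIf a0); rewrite /= [LHS]mulr_natr -h -mulr_natr addnS addSn !factS !natrM.
by move: (_^-1 : R) => c; ring.
Qed.

End poly_int.

(** * Jacobi polynomials with natural parameters *)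

Section jacobi.
Context {R : realType}.
Implicit Types p q u : {poly R}.

(** The points 1 / (i + 2) are as many common roots as desired. *)
Lemma poly_eq_itv p q : (forall t : R, -1 < t < 1 -> p.[t] = q.[t]) -> p = q.
Proof.
move=> pq; apply/eqP; rewrite -subr_eq0; apply/eqP.
apply: (@roots_geq_poly_eq0 _ _ [seq i.+2%:R^-1 | i <- iota 0 (size (p - q))]).
- apply/allP => _ /mapP[i _ ->]; rewrite /root hornerD hornerN pq ?subrr//.
  apply/andP; split; first by rewrite (lt_le_trans (ltrN10 _)).
  by rewrite invf_lt1 ?ltr0n// ltr1n.
- rewrite map_inj_uniq ?iota_uniq// => i j /invr_inj /eqP.
  by rewrite eqr_nat => /eqP[].
- by rewrite size_map size_iota.
Qed.

Lemma derive1n_horner (f : R -> R) p n : (forall t, -1 < t < 1 -> f t = p.[t]) ->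
  forall t, -1 < t < 1 -> derive1n n f t = (derivn n p).[t].
Proof.
move=> fp; elim: n => [|n IHn] t t11; first by rewrite derive1n0 fp.
have [_ <-] := is_derive_poly (derivn n p) t.
rewrite derive1nS derive1E; apply: near_eq_derive.
have /andP[t1 t2] := t11.
near=> s; apply: IHn; apply/andP; split; near: s.
- exact: lt_nbhsr.
- exact: lt_nbhsl.
Unshelve. all: end_near. Qed.

(** For natural exponents the real powers in [rodrigues] are polynomials on
    ]-1, 1[, and Rodrigues' formula becomes an identity between polynomials. *)
Lemma jacobi_rodrigues n a b :
  @jacobi_weight R a b * jacobi n a%:R b%:R =
  ((-1) ^+ n / (2 ^+ n * n`!%:R)) *: derivn n (@jacobi_weight R (n + a) (n + b)).
Proof.
apply: poly_eq_itv => t t11; have /andP[t1 t2] := t11.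
have t1' : 0 <= 1 + t by lra.
have t2' : 0 <= 1 - t by lra.
have := jacobiP n a%:R b%:R t11; rewrite !powR_mulrn// => h.
rewrite /jacobi_weight !hornerM !horner_exp horner_1BX horner_1DX h hornerZ.
congr (_ * _); apply: derive1n_horner => // s /andP[s1 s2].
rewrite -!natrD !powR_mulrn; [|lra|lra].
by rewrite hornerM !horner_exp horner_1BX horner_1DX.
Qed.

(** Every derivative lowers the order of the zeros at 1 and -1 by at most one. *)
Lemma derivn_jacobi_weight k a b : exists r,
  derivn k (@jacobi_weight R (k + a) (k + b)) = @jacobi_weight R a b * r.
Proof.
(* The extra factor [c] makes the induction hypothesis apply to derivatives. *)
suff H c : exists r,
    derivn k (@jacobi_weight R (k + a) (k + b) * c) = @jacobi_weight R a b * r.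
  by have [r] := H 1; rewrite mulr1 => ->; exists r.
elim: k c => [|k IHk] c; first by exists c.
rewrite derivSn !addSn !derivM /jacobi_weight deriv_1BXn deriv_1DXn.
pose c' : {poly R} :=
  (- (1 + 'X) *+ (k + a).+1 + (1 - 'X) *+ (k + b).+1) * c +
  (1 - 'X) * (1 + 'X) * deriv c.
have [r rE] := IHk c'; exists r; rewrite -rE; congr derivn.
rewrite /jacobi_weight /c' !exprS.
move: ((1 - 'X : {poly R}) ^+ _) ((1 + 'X : {poly R}) ^+ _) => x y.
move: ((k + a).+1) ((k + b).+1) (1 - 'X : {poly R}) (1 + 'X : {poly R}).
move: (deriv c) => d i j u v.
by ring.
Qed.

(** Integration by parts [k] times; the boundary terms vanish because of
    [derivn_jacobi_weight]. *)
Lemma poly_int_derivn n a b k q : (k <= n)%N ->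
  poly_int (derivn n (@jacobi_weight R (n + a) (n + b)) * q) =
  (-1) ^+ k * poly_int (derivn (n - k) (@jacobi_weight R (n + a) (n + b)) * derivn k q).
Proof.
elim: k => [|k IHk] kn; first by rewrite subn0 expr0 mul1r.
rewrite IHk; last exact: ltnW.
have -> : (n - k = (n - k.+1).+1)%N by rewrite subnSK.
rewrite derivnS poly_int_parts.
- by rewrite derivnS exprS mulrN mulN1r mulNr.
- have [r] := derivn_jacobi_weight (n - k.+1) (k.+1 + a) (k.+1 + b).
  rewrite !addnA subnK// => ->; rewrite /jacobi_weight !hornerM !horner_exp horner_1BX.
  by rewrite addSn subrr expr0n/= !mul0r.
- have [r] := derivn_jacobi_weight (n - k.+1) (k.+1 + a) (k.+1 + b).
  rewrite !addnA subnK// => ->; rewrite /jacobi_weight !hornerM !horner_exp horner_1DX.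
  by rewrite addrC subrr addSn expr0n/= mulr0 mul0r.
Qed.

Lemma poly_int_jacobi n a b q :
  poly_int (@jacobi_weight R a b * jacobi n a%:R b%:R * q) =
  (2 ^+ n * n`!%:R)^-1 * poly_int (@jacobi_weight R (n + a) (n + b) * derivn n q).
Proof.
rewrite jacobi_rodrigues -scalerAl linearZ/= (@poly_int_derivn n a b n)//.
rewrite subnn derivn0 mulrA; congr (_ * _).
by rewrite mulrAC -exprMn mulrNN mulr1 expr1n mul1r.
Qed.

Lemma jacobi_orthogonal_low n a b q : (size q <= n)%N ->
  poly_int (@jacobi_weight R a b * jacobi n a%:R b%:R * q) = 0.
Proof.
by move=> qn; rewrite poly_int_jacobi derivn_poly0// mulr0 raddf0 mulr0.
Qed.

Lemma size_jacobi_weight a b : size (@jacobi_weight R a b) = (a + b).+1.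
Proof.
have s1 : size (1 - 'X : {poly R}) = 2%N.
  by rewrite -opprB size_polyN -['X - 1]/('X - 1%:P) size_XsubC.
have s2 : size (1 + 'X : {poly R}) = 2%N by rewrite addrC size_XaddC.
have n1 : (1 - 'X : {poly R}) != 0 by rewrite -size_poly_eq0 s1.
have n2 : (1 + 'X : {poly R}) != 0 by rewrite -size_poly_eq0 s2.
rewrite /jacobi_weight size_mul ?expf_neq0//.
have := size_exp (1 - 'X : {poly R}) a; have := size_exp (1 + 'X : {poly R}) b.
rewrite s1 s2 !mul1n.
have : size ((1 - 'X : {poly R}) ^+ a) != 0%N by rewrite size_poly_eq0 expf_neq0.
have : size ((1 + 'X : {poly R}) ^+ b) != 0%N by rewrite size_poly_eq0 expf_neq0.
by case: (size _) => // x; case: (size _) => // y _ _ /= -> ->; rewrite addnS.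
Qed.

Lemma lead_coef_jacobi_weight a b : lead_coef (@jacobi_weight R a b) = (-1) ^+ a.
Proof.
rewrite lead_coefM !lead_coef_exp -opprB lead_coefN -['X - 1]/('X - 1%:P) lead_coefXsubC.
by rewrite addrC lead_coefXaddC expr1n mulr1.
Qed.

(** Compare degrees and leading coefficients in Rodrigues' formula. *)
Lemma jacobi_size_lead n a b :
  size (jacobi n (a%:R : R) b%:R) = n.+1 /\
  lead_coef (jacobi n (a%:R : R) b%:R) =
  ((n + n + a + b) ^_ n)%:R / (2 ^+ n * n`!%:R).
Proof.
set p := jacobi _ _ _; pose W := @jacobi_weight R (n + a) (n + b).
pose c : R := (-1) ^+ n / (2 ^+ n * n`!%:R).
have wp : jacobi_weight a b * p = c *: derivn n W by exact: jacobi_rodrigues.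
have sW : size W = (n + (n + a + b)).+1 by rewrite size_jacobi_weight addnACA !addnA.
have fN0 m : m`!%:R != 0 :> R by rewrite pnatr_eq0 -lt0n fact_gt0.
have c0 : c != 0.
  by rewrite mulf_neq0 ?invr_neq0 ?mulf_neq0 ?fN0 ?expf_neq0 ?oppr_eq0 ?oner_eq0 ?pnatr_eq0.
have DW : (derivn n W)`_(n + a + b) = (-1) ^+ (n + a) * ((n + n + a + b) ^_ n)%:R.
  rewrite coef_derivn -[W`_ _ in LHS]/(W`_((n + (n + a + b)).+1.-1)) -sW.
  by rewrite -lead_coefE lead_coef_jacobi_weight mulr_natr !addnA.
have DW0 : (derivn n W)`_(n + a + b) != 0.
  rewrite DW mulf_neq0 ?expf_neq0 ?oppr_eq0 ?oner_eq0// pnatr_eq0 -lt0n ffact_gt0.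
  by rewrite -!addnA leq_addr.
have sD : size (derivn n W) = (n + a + b).+1.
  apply/eqP; rewrite eqn_leq; apply/andP; split.
    apply/leq_sizeP => j hj; rewrite coef_derivn nth_default ?mul0rn// sW.
    by rewrite ltn_add2l.
  by rewrite ltnNge; apply: contra DW0 => h; rewrite nth_default.
have D0 : derivn n W != 0 by rewrite -size_poly_eq0 sD.
have w0 : @jacobi_weight R a b != 0 by rewrite -size_poly_eq0 size_jacobi_weight.
have p0 : p != 0.
  have : jacobi_weight a b * p != 0 by rewrite wp scaler_eq0 negb_or c0.
  by rewrite mulf_eq0 negb_or => /andP[].
have sp : size p = n.+1.
  have := congr1 (fun q : {poly R} => size q) wp.
  rewrite size_mul// size_scale// sD size_jacobi_weight addSn /= => h.
  by apply/eqP; rewrite -(eqn_add2l (a + b)) h addnS -addnA [(n + _)%N]addnC.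
split=> //.
have := congr1 lead_coef wp.
rewrite lead_coefM lead_coefZ lead_coef_jacobi_weight.
rewrite [lead_coef (derivn _ _)]lead_coefE sD /= DW.
move=> h; apply: (@mulfI R ((-1) ^+ a)); first by rewrite expf_neq0 ?oppr_eq0 ?oner_eq0.
rewrite h /c exprD; set e := (-1) ^+ n.
have ee : e * e = 1 by rewrite -exprMn mulrNN mulr1 expr1n.
rewrite -[RHS]mul1r -ee; ring.
Qed.

(** In [poly_int_jacobi] with the Jacobi polynomial itself as test function, its
    [n]-th derivative is a constant, known from the leading coefficient, and a
    Beta integral remains. *)
Lemma jacobi_norm n a b :
  poly_int (jacobi_weight a b * jacobi n a%:R b%:R * jacobi n (a%:R : R) b%:R) =
  2 ^+ (a + b).+1 / (n + n + a + b).+1%:R * ((n + a)`!%:R * (n + b)`!%:R)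
   / (n`!%:R * (n + a + b)`!%:R).
Proof.
rewrite poly_int_jacobi; set p := jacobi _ _ _.
have [sp lp] := jacobi_size_lead n a b; rewrite -/p in sp lp.
have -> : derivn n p = (lead_coef p * n`!%:R)%:P.
  apply/polyP => i; rewrite coef_derivn coefC; case: i => [|i]; last first.
    by rewrite nth_default ?mul0rn// sp addnS ltnS leq_addr.
  by rewrite addn0 ffactnn lead_coefE sp mulr_natr.
rewrite [_ * _%:P]mulrC mul_polyC linearZ/= poly_int_jacobi_weight lp.
have fN0 m : m`!%:R != 0 :> R by rewrite pnatr_eq0 -lt0n fact_gt0.
have N1 : (n + n + a + b).+1%:R != 0 :> R by rewrite pnatr_eq0.
have E : (n + n + a + b = n + (n + a + b))%N by rewrite !addnA.
have -> : ((n + n + a + b) ^_ n)%:R = (n + n + a + b)`!%:R / (n + a + b)`!%:R :> R.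
  apply: (mulIf (fN0 (n + a + b)%N)); rewrite -mulrA mulVf// mulr1 -natrM.
  have := ffact_fact (leq_addr (n + a + b) n); rewrite -E => <-.
  by rewrite E addKn.
have -> : (n + a + (n + b) = n + n + a + b)%N by rewrite addnACA addnA.
rewrite factS natrM.
have -> : (n + n + a + b).+1 = (n + n + (a + b).+1)%N by rewrite addnS !addnA.
rewrite !exprD.
have e0 : (2 ^+ n : R) != 0 by rewrite expf_neq0// pnatr_eq0.
move: (fN0 n) (fN0 (n + a + b)%N) (fN0 (n + n + a + b)%N) N1 e0.
have -> : (n + n + (a + b).+1)%N = (n + n + a + b).+1 by rewrite addnS !addnA.
move: (n`!%:R : R) (_`!%:R : R) (_`!%:R : R) (_`!%:R : R) (_.+1%:R : R) (2 ^+ n : R).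
move=> u v w z x y v0 w0 z0 x0 y0; field; rewrite ?v0 ?w0 ?x0 ?y0 ?z0//.
Qed.
End jacobi.

(** * Polynomials on a triangle and the Jacobi basis *)

Section tspan.
Context {R : realType} (K : triangle R).
Implicit Types (f g v : R * R -> R) (S : set (R * R -> R)) (phi : nat -> nat -> R * R -> R).

Definition eqK f g := forall x, triangle_set K x -> f x = g x.

(** A linear subspace, or the empty set, of functions on the triangle, functions
    that agree on the triangle being identified. *)
Definition linear_class S := forall c f g h, S f -> S g ->
  eqK h (fun x => c * f x + g x) -> S h.

Lemma linear_class_eqK S f g : linear_class S -> S f -> eqK g f -> S g.
Proof.
move=> lS Sf gf; apply: (lS (0 : R) f f) => // x xK.
by rewrite mul0r add0r gf.
Qed.

Lemma linear_class0 S f : linear_class S -> S f -> S (fun=> 0).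
Proof.
by move=> lS Sf; apply: (lS (-1) f f) => // x xK; rewrite mulN1r addNr.
Qed.

Lemma linear_classZ S f c : linear_class S -> S f -> S (fun x => c * f x).
Proof.
move=> lS Sf; apply: (lS c f _ _ Sf (linear_class0 lS Sf)) => x xK.
by rewrite addr0.
Qed.

Lemma linear_class_bigsum S (T : finType) (P : pred T) (F : T -> R * R -> R) :
  linear_class S -> S (fun=> 0) -> (forall i, P i -> S (F i)) ->
  S (fun x => \sum_(i | P i) F i x).
Proof.
move=> lS S0 SF.
suff H s : S (fun x => \sum_(i <- s | P i) F i x) by exact: H.
elim: s => [|i s IHs].
  by apply: (linear_class_eqK lS S0) => x _; rewrite big_nil.
have [Pi|Pi] := boolP (P i).
  apply: (lS 1 _ _ _ (SF i Pi) IHs) => x _.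
  by rewrite big_cons Pi mul1r.
by apply: linear_class_eqK IHs _ => // x _; rewrite big_cons (negbTE Pi).
Qed.

(** The span of the [phi i j] of total degree at most [d].  It gives the
    polynomials of degree at most [d] when the [phi i j] are monomials in two affine
    coordinates, and the expansions in the Jacobi basis when they are the
    [tjacobi i j] below. *)
Definition tspan phi d : set (R * R -> R) := [set v | exists c : nat -> nat -> R,
  forall x, triangle_set K x ->
    v x = \sum_(i < d.+1) \sum_(j < d.+1 | (i + j <= d)%N) c i j * phi i j x].

Lemma tspan_linear phi d : linear_class (tspan phi d).
Proof.
move=> a f g h [c fc] [c' gc'] hE.
exists (fun i j => a * c i j + c' i j) => x xK.
rewrite hE// fc// gc'// mulr_sumr -big_split/=; apply: eq_bigr => i _.
rewrite mulr_sumr -big_split/=; apply: eq_bigr => j _.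
by rewrite mulrDl mulrA.
Qed.

Lemma tspan0 phi d : tspan phi d (fun=> 0).
Proof.
exists (fun _ _ => 0) => x _; rewrite big1// => i _; rewrite big1// => j _.
by rewrite mul0r.
Qed.

Lemma mem_tspan phi d i j : (i + j <= d)%N -> tspan phi d (phi i j).
Proof.
move=> ijd; exists (fun k l => ((k == i) && (l == j))%:R) => x _.
have id : (i < d.+1)%N by rewrite ltnS (leq_trans (leq_addr j i)).
have jd : (j < d.+1)%N by rewrite ltnS (leq_trans (leq_addl i j)).
rewrite (bigD1 (Ordinal id))//= [X in _ + X]big1 ?addr0; last first.
  move=> k /negbTE; rewrite -val_eqE/= => ki.
  by rewrite big1// => l _; rewrite ki mul0r.
rewrite (bigD1 (Ordinal jd))//= [X in _ + X]big1 ?addr0; last first.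
  move=> k /andP[_ /negbTE]; rewrite -val_eqE/= => ki.
  by rewrite ki andbF mul0r.
by rewrite !eqxx mul1r.
Qed.

Lemma tspan_sub phi d S : linear_class S -> S (fun=> 0) ->
  (forall i j, (i + j <= d)%N -> S (phi i j)) -> tspan phi d `<=` S.
Proof.
move=> lS S0 Sphi v [c vc].
apply: (@linear_class_eqK _ (fun x => \sum_(i < d.+1)
  \sum_(j < d.+1 | (i + j <= d)%N) c i j * phi i j x)) => //.
apply: linear_class_bigsum => // i _; apply: linear_class_bigsum => // j ij.
by apply: linear_classZ => //; exact: Sphi.
Qed.

Lemma tspan_le phi d d' : (d <= d')%N -> tspan phi d `<=` tspan phi d'.
Proof.
move=> dd'; apply: tspan_sub; [exact: tspan_linear|exact: tspan0|].
by move=> i j ij; apply: mem_tspan; exact: leq_trans ij dd'.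
Qed.

Definition monom (e1 e2 : R * R -> R) i j x := e1 x ^+ i * e2 x ^+ j.

Section affine.
Variables e1 e2 : R * R -> R.
Let V := tspan (monom e1 e2).

(** Multiplication by an affine function raises the degree by one.  As the [v]
    with this property form a linear class, monomials are enough. *)
Lemma tspan_affine f d (a b c : R) : eqK f (fun x => a + b * e1 x + c * e2 x) ->
  forall v, V d v -> V d.+1 (fun x => f x * v x).
Proof.
move=> fE.
have lV := @tspan_linear (monom e1 e2).
suff H : V d `<=` [set v | V d.+1 (fun x => f x * v x)] by [].
apply: tspan_sub => [r g h k Sg Sh kE||i j ij] /=.
- apply: (lV _ r _ _ _ Sg Sh) => x xK; rewrite kE//; ring.
- by apply: linear_class_eqK (tspan0 _ d.+1) _ => // x _; rewrite mulr0.
have m1 : V d.+1 (monom e1 e2 i.+1 j) by exact: mem_tspan.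
have m2 : V d.+1 (monom e1 e2 i j.+1) by apply: mem_tspan; rewrite addnS.
have m0 : V d.+1 (monom e1 e2 i j) by apply: mem_tspan; exact: leqW.
apply: (lV _ a _ _ _ m0 (lV _ b _ _ _ m1 (linear_classZ c (lV _) m2) (fun _ _ => erefl))).
by move=> x xK; rewrite fE// /monom !exprS; ring.
Qed.

Lemma tspan_affineX f k d (a b c : R) : eqK f (fun x => a + b * e1 x + c * e2 x) ->
  forall v, V d v -> V (k + d) (fun x => f x ^+ k * v x).
Proof.
move=> fE v vd; elim: k => [|k IHk].
  by apply: linear_class_eqK vd _; [exact: tspan_linear|move=> x _; rewrite mul1r].
rewrite addSn; apply: linear_class_eqK (tspan_affine fE IHk) _; first exact: tspan_linear.
by move=> x _; rewrite exprS mulrA.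
Qed.

Lemma tspan1 d : V d (fun=> 1).
Proof.
have : V d (monom e1 e2 0 0) by exact: mem_tspan.
move=> h; apply: linear_class_eqK h _; first exact: tspan_linear.
by move=> x _; rewrite /monom mulr1.
Qed.

End affine.

(** Every monomial in [f1] and [f2] arises from 1 by multiplying with affine
    functions of [e1] and [e2]. *)
Lemma tspan_change (e1 e2 f1 f2 : R * R -> R) (a b c a' b' c' : R) d :
  eqK f1 (fun x => a + b * e1 x + c * e2 x) ->
  eqK f2 (fun x => a' + b' * e1 x + c' * e2 x) ->
  tspan (monom f1 f2) d `<=` tspan (monom e1 e2) d.
Proof.
move=> f1E f2E; apply: tspan_sub; [exact: tspan_linear|exact: tspan0|].
move=> i j ij; apply: tspan_le ij _ _.
have := tspan_affineX i f1E (tspan_affineX j f2E (@tspan1 e1 e2 0)).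
rewrite addn0 => h; apply: linear_class_eqK h _; first exact: tspan_linear.
by move=> x _; rewrite mulr1.
Qed.

Lemma PpolyE d : Ppoly K (Posz d) = tspan (monom fst snd) d.
Proof.
apply/seteqP; split=> v [c vc]; exists c => x xK; rewrite vc//;
  by apply: eq_bigr => i _; apply: eq_bigr => j _; rewrite mulrA.
Qed.

End tspan.

Section jacobi_basis.
Context {R : realType} (K : triangle R).

Definition bary23_sum x := bary2 K x + bary3 K x.
Definition bary23_diff x := bary2 K x - bary3 K x.
(** In collapsed coordinates the Jacobi polynomial of the triangle is, up to a
    power of 1 - s, a polynomial in s, the radial one, times a polynomial in t,
    the angular one. *)
Definition radial_jacobi k l : {poly R} := jacobi l (2 * k + 5)%:R 2%:R.
Definition angular_jacobi k : {poly R} := jacobi k 2%:R 2%:R.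
(** The homogenization [(l2 + l3)^k P_k((l2 - l3) / (l2 + l3))], free of
    division. *)
Definition angular_form k x := \sum_(i < k.+1)
  (angular_jacobi k)`_i * bary23_diff x ^+ i * bary23_sum x ^+ (k - i).
(** Indexed so that [k] and [l] are the degrees of the angular and of the radial
    factor and the total degree is [k + l], as for monomials. *)
Definition tjacobi k l : R * R -> R := jacobi_K K k (k + l).

Lemma bary_sum x : bary1 K x + bary2 K x + bary3 K x = 1.
Proof.
by have [/(_ (conj erefl (conj erefl erefl)))[]] :=
  baryP K x (bary1 K x) (bary2 K x) (bary3 K x).
Qed.

Lemma bary_coord x :
  x = (bary1 K x * (vtx1 K).1 + bary2 K x * (vtx2 K).1 + bary3 K x * (vtx3 K).1,
       bary1 K x * (vtx1 K).2 + bary2 K x * (vtx2 K).2 + bary3 K x * (vtx3 K).2).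
Proof.
by have [/(_ (conj erefl (conj erefl erefl)))[]] :=
  baryP K x (bary1 K x) (bary2 K x) (bary3 K x).
Qed.

Lemma tjacobiE k l x : tjacobi k l x =
  bary23_sum x ^+ k * (radial_jacobi k l).[bary1 K x - bary2 K x - bary3 K x]
  * (angular_jacobi k).[bary23_diff x / bary23_sum x].
Proof.
rewrite /tjacobi /jacobi_K /jacobi_triangle addKn /radial_jacobi.
rewrite /angular_jacobi /bary23_sum /bary23_diff.
by have -> : 2 * k%:R + 2 + 2 + 1 = (2 * k + 5)%:R :> R by rewrite natrD natrM; ring.
Qed.

(** At the vertex where [l2 + l3 = 0] the quotient is 0 by convention; there both
    sides vanish if [k > 0], and if [k = 0] the angular factor is a constant. *)
Lemma tjacobi_poly k l : eqK K (tjacobi k l)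
  (fun x => angular_form k x * (radial_jacobi k l).[1 - 2 * bary23_sum x]).
Proof.
move=> x /triangle_setE[_ h2 h3]; rewrite tjacobiE mulrAC; congr (_ * _.[_]); last first.
  by have := bary_sum x; rewrite /bary23_sum; lra.
rewrite horner_coef (jacobi_size_lead k 2 2).1 mulr_sumr /angular_form.
have [s0|s0] := eqVneq (bary23_sum x) 0; last first.
  apply: eq_bigr => -[i /=]; rewrite ltnS => ik _.
  have -> : bary23_sum x ^+ k = bary23_sum x ^+ (k - i) * bary23_sum x ^+ i.
    by rewrite -exprD subnK.
  rewrite expr_div_n.
  move: (expf_neq0 i s0).
  move: (_ ^+ i : R) (_ ^+ i : R) (_ ^+ (k - i) : R) => u v w v0.
  by field.
have d0 : bary23_diff x = 0 by move: s0; rewrite /bary23_sum /bary23_diff; lra.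
rewrite s0 d0; case: k => [|k]; first by rewrite !big_ord1 !expr0 !mul1r !mulr1.
rewrite !big1// => -[i _] _ /=; last by rewrite expr0n !mul0r.
by case: i => [|i]; rewrite ?subn0 !expr0n/= ?mulr0 ?mul0r.
Qed.

Lemma affine_bary : exists a b c a' b' c' : R,
  eqK K bary23_sum (fun x => a + b * x.1 + c * x.2) /\
  eqK K bary23_diff (fun x => a' + b' * x.1 + c' * x.2).
Proof.
rewrite /bary23_sum /bary23_diff /bary2 /bary3; set D := (cross _ _ _)^-1.
rewrite /cross; case: (vtx1 K) (vtx2 K) (vtx3 K) => [a1 b1] [a2 b2] [a3 b3] /=.
exists (D * (- a1 * (b3 - b1) + (a3 - a1) * b1 - (a2 - a1) * b1 + a1 * (b2 - b1))),
 (D * ((b3 - b1) - (b2 - b1))), (D * ((a2 - a1) - (a3 - a1))),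
 (D * (- a1 * (b3 - b1) + (a3 - a1) * b1 + (a2 - a1) * b1 - a1 * (b2 - b1))),
 (D * ((b3 - b1) + (b2 - b1))), (D * (- (a2 - a1) - (a3 - a1))).
by split=> x _; ring.
Qed.

Lemma affine_coord : exists a b c a' b' c' : R,
  eqK K fst (fun x => a + b * bary23_diff x + c * bary23_sum x) /\
  eqK K snd (fun x => a' + b' * bary23_diff x + c' * bary23_sum x).
Proof.
exists (vtx1 K).1, (((vtx2 K).1 - (vtx3 K).1) / 2),
  (((vtx2 K).1 + (vtx3 K).1) / 2 - (vtx1 K).1).
exists (vtx1 K).2, (((vtx2 K).2 - (vtx3 K).2) / 2),
  (((vtx2 K).2 + (vtx3 K).2) / 2 - (vtx1 K).2).
split=> x _; rewrite [in LHS](bary_coord x) /=; have := bary_sum x;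
  rewrite /bary23_diff /bary23_sum => h;
  have -> : bary1 K x = 1 - bary2 K x - bary3 K x by lra.
all: by field.
Qed.

Lemma Ppoly_bary23 d : Ppoly K (Posz d) = tspan K (monom bary23_diff bary23_sum) d.
Proof.
rewrite PpolyE; apply/seteqP; split.
  have [a [b [c [a' [b' [c' [h h']]]]]]] := affine_coord.
  exact: tspan_change h h'.
have [a [b [c [a' [b' [c' [h h']]]]]]] := affine_bary.
exact: tspan_change h' h.
Qed.

Lemma linear_class_Ppoly d : linear_class K (Ppoly K (Posz d)).
Proof. by rewrite PpolyE; exact: tspan_linear. Qed.

Lemma tjacobi_Ppoly k l : Ppoly K (Posz (k + l)) (tjacobi k l).
Proof.
have lP := @linear_class_Ppoly (k + l).
apply: (linear_class_eqK lP) (@tjacobi_poly k l).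
rewrite Ppoly_bary23 in lP *.
have P0 := @tspan0 _ K (monom bary23_diff bary23_sum) (k + l).
have sE : eqK K (fun x => 1 - 2 * bary23_sum x)
    (fun x => 1 + 0 * bary23_diff x + (- 2) * bary23_sum x).
  by move=> x _; ring.
apply: (@linear_class_eqK _ _ _ (fun x => \sum_(i < k.+1) \sum_(j < l.+1)
  ((angular_jacobi k)`_i * (radial_jacobi k l)`_j) *
  ((1 - 2 * bary23_sum x) ^+ j * monom bary23_diff bary23_sum i (k - i) x))
  _ lP).
  apply: (linear_class_bigsum lP P0) => -[i /=]; rewrite ltnS => ik _.
  apply: (linear_class_bigsum lP P0) => -[j /=]; rewrite ltnS => jl _.
  apply: (linear_classZ _ lP); apply: (@tspan_le _ _ _ (j + k) (k + l) _ _ _).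
    by rewrite addnC leq_add2l.
  by apply: (tspan_affineX j sE); apply: mem_tspan; rewrite subnKC.
move=> x _; rewrite /angular_form mulr_suml; apply: eq_bigr => i _.
rewrite horner_coef (jacobi_size_lead l _ _).1 mulr_sumr; apply: eq_bigr => j _.
by rewrite /monom; ring.
Qed.

(** The member of the family of the same degree removes the leading term. *)
Lemma linear_pred_poly (p : nat -> {poly R}) (V : {poly R} -> Prop) N :
  (forall i, size (p i) = i.+1) ->
  (forall c f g, V f -> V g -> V (c *: f + g)) -> V 0 ->
  (forall i, (i <= N)%N -> V (p i)) ->
  forall h : {poly R}, (size h <= N.+1)%N -> V h.
Proof.
move=> sp lV V0; elim: N => [|N IHN] Vp h hN.
  rewrite (_ : h = h`_0 / (p 0%N)`_0 *: p 0%N + 0); first by apply: lV => //; exact: Vp.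
  have p0 : (p 0%N)`_0 != 0.
    by have := lead_coef_eq0 (p 0%N); rewrite lead_coefE sp/= -size_poly_eq0 sp => ->.
  have := sp 0%N => /eqP sp0; rewrite addr0.
  rewrite [p 0%N]size1_polyC ?sp// [h]size1_polyC// !coefC/= -mul_polyC -polyCM.
  by rewrite mulfVK.
pose c := h`_N.+1 / lead_coef (p N.+1).
have pN : lead_coef (p N.+1) != 0 by rewrite lead_coef_eq0 -size_poly_eq0 sp.
rewrite (_ : h = c *: p N.+1 + (h - c *: p N.+1)); last by rewrite addrC subrK.
apply: lV; first exact: Vp.
apply: IHN => [i iN|]; first exact/Vp/leqW.
apply/leq_sizeP => j; rewrite leq_eqVlt => /predU1P[<-|Nj].
  rewrite coefB coefZ /c lead_coefE sp/= mulfVK ?subrr//.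
  by rewrite -[X in _`_X]/(N.+1.+1.-1) -(sp N.+1) -lead_coefE.
by rewrite coefB coefZ !nth_default ?mulr0 ?subrr ?sp// (leq_trans hN).
Qed.

(** Every linear class that contains the Jacobi polynomials contains the
    monomials in u = l2 - l3 and w = l2 + l3, by induction on the exponent i of
    u.  The radial polynomials span all polynomials in w, so the angular form of
    degree i times w^j is in the class; its u^i w^j term has a nonzero
    coefficient, and the remaining terms have lower exponents of u and the same
    total degree. *)
Lemma Ppoly_sub_span_tjacobi n (S : set (R * R -> R)) : linear_class K S -> S (fun=> 0) ->
  (forall k l, (k + l <= n)%N -> S (tjacobi k l)) -> Ppoly K (Posz n) `<=` S.
Proof.
move=> lS S0 SJ; rewrite Ppoly_bary23; apply: tspan_sub => //.
elim/ltn_ind => i IHi j ijn.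
have q0 : (angular_jacobi i)`_i != 0.
  have [sq _] := jacobi_size_lead (R := R) i 2 2.
  by have := lead_coef_eq0 (angular_jacobi i); rewrite lead_coefE sq/= -size_poly_eq0 sq => ->.
have SG (h : {poly R}) : (size h <= (n - i).+1)%N ->
    S (fun x => angular_form i x * h.[1 - 2 * bary23_sum x]).
  pose V (h : {poly R}) := S (fun x => angular_form i x * h.[1 - 2 * bary23_sum x]).
  apply: (@linear_pred_poly (radial_jacobi i) V) => [l|c f g Sf Sg||l ln].
  - exact: (jacobi_size_lead l _ _).1.
  - by apply: (lS c _ _ _ Sf Sg) => x _; rewrite hornerD hornerZ; ring.
  - by apply: (linear_class_eqK lS S0) => x _; rewrite horner0 mulr0.
  - apply: (linear_class_eqK lS (SJ i l _)).
      by rewrite -leq_subRL// (leq_trans (leq_addr j i)).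
    by move=> x xK; rewrite tjacobi_poly.
(* In terms of s = 1 - 2 w the power w^j is ((1 - s) / 2)^j. *)
have SGj : S (fun x => angular_form i x * bary23_sum x ^+ j).
  have sh : (size ((2^-1 *: (1 - 'X)) ^+ j : {poly R})%R <= (n - i).+1)%N.
    rewrite (leq_trans (size_poly_exp_leq _ _))// ltnS leq_subRL ?(leq_trans (leq_addr j i))//.
    have -> : size (2^-1 *: (1 - 'X) : {poly R}) = 2%N.
      rewrite size_scale ?invr_neq0// -opprB size_polyN -['X - 1]/('X - 1%:P).
      by rewrite size_XsubC.
    by rewrite mul1n.
  apply: (linear_class_eqK lS (SG _ sh)) => x _.
  by rewrite horner_exp hornerZ horner_1BX; congr (_ * _ ^+ _); field.
have Slow : S (fun x => \sum_(l < i)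
    (angular_jacobi i)`_l * monom bary23_diff bary23_sum l (i - l + j) x).
  apply: (linear_class_bigsum lS S0) => -[l /= li] _; apply: (linear_classZ _ lS).
  by apply: IHi => //; rewrite addnA subnKC// ltnW.
apply: (lS ((angular_jacobi i)`_i)^-1 _ _ _ (lS (-1) _ _ _ Slow SGj (fun _ _ => erefl)) S0).
move=> x _; rewrite addr0 /angular_form big_ord_recr/= subnn expr0 mulr1.
apply: (mulfI q0); rewrite /= [RHS]mulrA mulfV// mul1r mulrDl mulr_suml /monom mulN1r.
rewrite addrA [X in _ = X + _](_ : _ = 0) ?add0r ?mulrA//.
apply/eqP; rewrite addrC subr_eq0; apply/eqP; apply: eq_bigr => l _.
by rewrite exprD; ring.
Qed.

End jacobi_basis.

(** * The weighted form in the Jacobi basis *)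

Section form.
Context {R : realType} (K : triangle R).
Local Notation RR := (measurableTypeR R * measurableTypeR R)%type.

Lemma Ppoly_measurable d v : Ppoly K (Posz d) v ->
  measurable_fun (triangle_set K : set RR) (v : RR -> measurableTypeR R).
Proof.
move=> [c vc].
pose c' i j := if (i + j <= d)%N then c i j else 0.
apply: (@eq_measurable_fun _ _ _ _ _ (fun x : RR =>
  \sum_(i < d.+1) \sum_(j < d.+1) c' i j * x.1 ^+ i * x.2 ^+ j : measurableTypeR R)).
  move=> x /set_mem xK; rewrite vc//; apply: eq_bigr => i _.
  rewrite [RHS]big_mkcond; apply: eq_bigr => j _; rewrite /c'.
  by case: ifP => //; rewrite !mul0r.
apply: measurable_funTS; apply: measurable_sum => i; apply: measurable_sum => j.
by apply: measurable_funM; [apply: measurable_funM => //|]; apply: measurable_funX.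
Qed.

Lemma chart_in_triangle s t : -1 <= s <= 1 -> -1 <= t <= 1 -> triangle_set K (chart K (s, t)).
Proof.
move=> /andP[s1 s2] /andP[t1 t2]; rewrite triangle_setE.
have [-> -> ->] := bary_chart K (s, t); split=> /=; first by lra.
  by rewrite divr_ge0// mulr_ge0//; lra.
by rewrite divr_ge0// mulr_ge0//; lra.
Qed.

Lemma tjacobi_chart k l s t :
  tjacobi K k l (chart K (s, t)) =
  ((1 - s) / 2) ^+ k * (radial_jacobi k l).[s] * (@angular_jacobi R k).[t].
Proof.
rewrite tjacobiE /bary23_sum /bary23_diff; have [-> -> ->] := bary_chart K (s, t) => /=.
have -> : (1 - s) * (1 + t) / 4 + (1 - s) * (1 - t) / 4 = (1 - s) / 2 by field.
have -> : (1 - s) * (1 + t) / 4 - (1 - s) * (1 - t) / 4 = (1 - s) / 2 * t by field.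
have -> : (1 + s) / 2 - (1 - s) * (1 + t) / 4 - (1 - s) * (1 - t) / 4 = s by field.
have [->|s1] := eqVneq s 1.
  rewrite subrr !mul0r; case: k => [|k]; last by rewrite expr0n !mul0r.
  have := jacobi_size_lead (R := R) 0 2 2; rewrite -/(angular_jacobi 0) => -[/eqP s1 _].
  have {s1} /size_poly1P [c _ ->] := s1.
  by rewrite !hornerC.
congr (_ * _.[_]); rewrite mulrC mulrA mulVf ?mul1r//.
by rewrite mulf_neq0 ?invr_neq0// subr_eq0 eq_sym.
Qed.

Lemma bubble_chart s t :
  bubble K (chart K (s, t)) = (1 + s) / 2 * ((1 - s) / 2) ^+ 2 * ((1 - t) * (1 + t) / 4).
Proof.
by rewrite /bubble; have [-> -> ->] := bary_chart K (s, t) => /=; field.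
Qed.

Lemma jacobi_orthogonal a b m n : m != n ->
  poly_int (jacobi_weight a b * jacobi m a%:R b%:R * jacobi n (a%:R : R) b%:R) = 0.
Proof.
rewrite neq_ltn => /orP[mn|nm]; last first.
  by apply: jacobi_orthogonal_low; rewrite (jacobi_size_lead n a b).1.
rewrite mulrAC; apply: jacobi_orthogonal_low; by rewrite (jacobi_size_lead m a b).1.
Qed.

(** The square of the weighted norm of [tjacobi k l], up to [chart_scale K].  The
    powers of 2 come from b_K^2 and the factor (l2 + l3)^(2k): in collapsed
    coordinates the former is ((1 + s) / 2)^2 ((1 - s) / 2)^4 ((1 - t^2) / 4)^2
    and the latter ((1 - s) / 2)^(2k). *)
Definition tjacobi_sqnorm k l : R := (2 ^+ (2 * k + 6))^-1 / 16 *
  poly_int (jacobi_weight (2 * k + 5) 2 * radial_jacobi k l * radial_jacobi k l) *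
  poly_int (jacobi_weight 2 2 * angular_jacobi k * angular_jacobi k).

(** Orthogonality and norms in one statement: pairing with [tjacobi k0 l0] for
    the weight b_K^2 reads off the corresponding coefficient.  The angular
    integral vanishes unless k = k0, and then the radial one unless l = l0. *)
Lemma weighted_int_tjacobi n (c : nat -> nat -> R) k0 l0 v :
  (forall x, triangle_set K x ->
    v x = \sum_(i < n.+1) \sum_(j < n.+1 | (i + j <= n)%N) c i j * tjacobi K i j x) ->
  triangle_int K (fun x => bubble K x ^+ 2 * tjacobi K k0 l0 x * v x) =
  (if (k0 + l0 <= n)%N then c k0 l0 else 0) * (chart_scale K * tjacobi_sqnorm k0 l0).
Proof.
move=> vE.
pose c' i j := if (i + j <= n)%N then c i j else 0.
pose X1 : {poly R} := 2^-1 *: (1 - 'X).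
pose X2 : {poly R} := 2^-1 *: (1 + 'X).
pose A (i : 'I_n.+1 * 'I_n.+1) : {poly R} := c' i.1 i.2 *:
  (X2 ^+ 2 * X1 ^+ (4 + i.1 + k0) * radial_jacobi i.1 i.2 * radial_jacobi k0 l0).
pose B (i : 'I_n.+1 * 'I_n.+1) : {poly R} :=
  16^-1 *: (jacobi_weight 2 2 * angular_jacobi i.1 * angular_jacobi k0).
rewrite (@triangle_int_chart _ _ _ _ A B); last 2 first.
- have [m1 m2 m3] := measurable_bary K.
  apply: measurable_funM; last first.
    apply: (@Ppoly_measurable n); have lP := @linear_class_Ppoly _ K n.
    apply: (@tspan_sub _ K (tjacobi K) n _ lP); last by exists c.
      by rewrite PpolyE; exact: tspan0.
    move=> i j ij; have := tjacobi_Ppoly K i j; rewrite !PpolyE; exact: tspan_le.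
  apply: measurable_funM; last exact: Ppoly_measurable (tjacobi_Ppoly K k0 l0).
  apply/measurable_funTS/measurable_funX.
  by apply: measurable_funM => //; apply: measurable_funM.
- move=> s t s1 t1; rewrite vE ?pair_big_dep/=; last exact: chart_in_triangle.
  rewrite big_mkcond mulr_sumr; apply: eq_bigr => -[i j] _ /=.
  rewrite /A /B /c' /=; case: ifP => _; last by rewrite scale0r horner0 mul0r mulr0.
  rewrite bubble_chart !tjacobi_chart /jacobi_weight.
  rewrite !(horner_exp, hornerZ, hornerM) horner_1BX !horner_1DX horner_1BX.
  rewrite !exprD -![2^-1 * _]mulrC.
  move: (_.[_] : R) (_.[_] : R) (_.[_] : R) (_.[_] : R).
  move: (_ ^+ k0 : R) (_ ^+ i : R) => x1 x2 x3 x4 x5 x6.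
  by field.
rewrite mulrCA; congr (_ * _).
have term i : poly_int ((1 - 'X) * A i) * poly_int (B i) =
    if (i.1 == k0 :> nat) && (i.2 == l0 :> nat) then c' k0 l0 * tjacobi_sqnorm k0 l0 else 0.
  case: i => i j /=; rewrite /A /B /=.
  have [->|ik] := eqVneq (i : nat) k0; last first.
    by rewrite [X in _ * X]linearZ/= jacobi_orthogonal// !mulr0.
  (* The Jacobian supplies the last of the 2 k0 + 5 factors 1 - s. *)
  have -> : (1 - 'X) * (c' k0 j *: (X2 ^+ 2 * X1 ^+ (4 + k0 + k0) *
        radial_jacobi k0 j * radial_jacobi k0 l0)) =
      (c' k0 j * (2 ^+ (2 * k0 + 6))^-1) *:
        (jacobi_weight (2 * k0 + 5) 2 * radial_jacobi k0 j * radial_jacobi k0 l0).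
    have -> : (2 ^+ (2 * k0 + 6))^-1 = 2^-1 ^+ 2 * 2^-1 ^+ (4 + k0 + k0) :> R.
      by rewrite -exprD exprVn; congr (_ ^+ _)^-1; lia.
    have -> : (2 * k0 + 5 = (4 + k0 + k0).+1)%N by lia.
    rewrite /X1 /X2 /jacobi_weight !exprZn [(1 - 'X) ^+ (_.+1)]exprS.
    move: (2^-1 ^+ 2 : R) (2^-1 ^+ (4 + k0 + k0) : R) (c' k0 j) => e1 e2 e3.
    rewrite -!mul_polyC !polyCM.
    move: (radial_jacobi k0 j) (radial_jacobi k0 l0) ((1 - 'X : {poly R}) ^+ _).
    by move: (1 - 'X : {poly R}) (1 + 'X : {poly R}) => *; ring.
  rewrite !linearZ/=.
  have [<-|jl] := eqVneq (j : nat) l0; last by rewrite jacobi_orthogonal// mulr0 mul0r.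
  by rewrite /tjacobi_sqnorm; ring.
under eq_bigr do rewrite term.
rewrite -big_mkcond /=.
have [kl|kl] := ifPn; last first.
  by rewrite mul0r big1// => i _; rewrite /c' (negbTE kl) mul0r.
have k0n : (k0 < n.+1)%N by rewrite ltnS (leq_trans (leq_addr l0 k0)).
have l0n : (l0 < n.+1)%N by rewrite ltnS (leq_trans (leq_addl k0 l0)).
rewrite (big_pred1 (Ordinal k0n, Ordinal l0n)) ?/c' ?kl//.
Qed.
End form.

(** * The shape functions *)

Section shape.
Context {R : realType} (K : triangle R).

Lemma eq_triangle_int f g : eqK K f g -> triangle_int K f = triangle_int K g.
Proof. by move=> fg; apply: eq_Rintegral => x /set_mem; exact: fg. Qed.

Lemma triangle_areaE : triangle_area K = 4 * chart_scale K.
Proof.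
have mK := @measurable_triangle R K.
have -> : triangle_area K = triangle_int K (cst 1).
  by rewrite /triangle_int Rintegral_cst// mul1r.
rewrite (@triangle_int_chart _ _ _ unit (fun=> 1) (fun=> 1)).
- have := @poly_int_jacobi_weight R 0 0; have := @poly_int_jacobi_weight R 1 0.
  rewrite /jacobi_weight !expr0 !expr1 !mulr1 => -> ->.
  by rewrite big_const card_unit/= !factS fact0; field.
- exact: measurable_cst.
- by move=> s t _ _; rewrite big_const card_unit/= !hornerC mulr1 addr0.
Qed.

Lemma chart_scale_neq0 : chart_scale K != 0.
Proof.
by rewrite mulf_neq0 ?invr_neq0 ?normr_eq0// vtx_noncollinear.
Qed.

(** [tjacobi k l] is the Jacobi polynomial with parameters k and n = k + l, for
    which r = n + 2. The value 4 is the ratio of the area to [chart_scale K]. *)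
Lemma bubble_coef_sqnorm k l : bubble_coef R (k + l).+2 k * @tjacobi_sqnorm R k l = 4.
Proof.
rewrite /tjacobi_sqnorm !jacobi_norm /bubble_coef.
have -> : (2 * k + 5 + 2).+1 = (2 * k + 6 + 2)%N by lia.
have -> : (l + (2 * k + 5) + 2 = (l + (2 * k + 5)).+2)%N by lia.
have -> : (k + 2 + 2 = (k + 2).+2)%N by lia.
rewrite [2 ^+ (2 * k + 6 + 2)]exprD !addn2 !factS !natrM.
have : k`!%:R != 0 :> R by rewrite pnatr_eq0 -lt0n fact_gt0.
have : l`!%:R != 0 :> R by rewrite pnatr_eq0 -lt0n fact_gt0.
have : (l + (2 * k + 5))`!%:R != 0 :> R by rewrite pnatr_eq0 -lt0n fact_gt0.
have : (2 ^+ (2 * k + 6) : R) != 0 by rewrite expf_neq0// pnatr_eq0.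
move: (_`!%:R : R) (_`!%:R : R) (_`!%:R : R) (_ ^+ (_ + 6) : R) => x y z u u0 z0 y0 x0.
rewrite mul2n -addnn -!natr1 !natrD.
have := ler0n R k; have := ler0n R l; move: (k%:R : R) (l%:R : R) => a b b0 a0.
field; rewrite ?u0 ?z0 ?y0 ?x0 /=.
repeat (apply/andP; split); apply: lt0r_neq0; lra.
Qed.

Lemma bubble_coef_neq0 k l : bubble_coef R (k + l).+2 k != 0.
Proof.
have := bubble_coef_sqnorm k l; apply: contra_eq_neq => ->.
by rewrite mul0r eq_sym.
Qed.

Lemma tjacobi_sqnorm_neq0 k l : @tjacobi_sqnorm R k l != 0.
Proof.
have := bubble_coef_sqnorm k l; apply: contra_eq_neq => ->.
by rewrite mulr0 eq_sym.
Qed.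

Lemma tjacobi_top n (k : 'I_n.+1) : tjacobi K k (n - k) = jacobi_K K k n.
Proof. by rewrite /tjacobi subnKC// -ltnS. Qed.

Lemma Ppoly_pred n : Ppoly K (n.+1%:Z - 1) = Ppoly K n%:Z.
Proof. by rewrite -addn1 PoszD addrK. Qed.

Lemma Ppoly_tspan_tjacobi n v : Ppoly K n%:Z v -> tspan K (tjacobi K) n v.
Proof.
apply: Ppoly_sub_span_tjacobi; [exact: tspan_linear|exact: tspan0|].
by move=> k l kl; exact: mem_tspan.
Qed.

(** For [n = 0] the space of [q] is zero; otherwise [q] expands in the Jacobi
    polynomials of degree less than [n]. *)
Lemma tjacobi_orth_lower n k l q : (k + l = n)%N -> Ppoly K (n%:Z - 1) q ->
  triangle_int K (fun x => bubble K x ^+ 2 * tjacobi K k l x * q x) = 0.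
Proof.
case: n => [|n] kln.
  move=> q0; rewrite (@eq_triangle_int _ (fun=> 0)); last first.
    by move=> x xK; rewrite q0// mulr0.
  by rewrite /triangle_int /Rintegral integral0.
rewrite Ppoly_pred => /Ppoly_tspan_tjacobi[c qc].
by rewrite (weighted_int_tjacobi k l qc) kln ltnn mul0r.
Qed.

Lemma weighted_int_tjacobi_top n (d : 'I_n.+1 -> R) (j : 'I_n.+1) v :
  eqK K v (fun x => \sum_k d k * jacobi_K K k n x) ->
  triangle_int K (fun x => bubble K x ^+ 2 * jacobi_K K j n x * v x) =
  d j * (chart_scale K * @tjacobi_sqnorm R j (n - j)).
Proof.
move=> vE; rewrite -tjacobi_top.
have jn : (j <= n)%N by rewrite -ltnS.
rewrite (@weighted_int_tjacobi R K n (fun i l => if (i + l == n)%N then d (inord i) else 0)).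
  by rewrite subnKC// leqnn eqxx inord_val.
move=> x xK; rewrite vE//; apply: eq_bigr => i _.
have iN : (i <= n)%N by rewrite -ltnS.
have ni : (n - i < n.+1)%N by rewrite ltnS leq_subr.
rewrite (bigD1 (Ordinal ni)) /= ?subnKC// eqxx inord_val tjacobi_top big1 ?addr0//.
move=> l /andP[_]; rewrite -val_eqE/= => ln.
rewrite ifN ?mul0r//; apply: contra ln => /eqP iln.
by apply/eqP; lia.
Qed.

(** The statement for degree [n = r - 2]. The functions lie in the bubble space
    by [tjacobi_orth_lower]; duality, and with it independence, is
    [weighted_int_tjacobi_top]; they span because orthogonality to lower degrees
    kills all coefficients of lower degree. *)
Lemma shape_functions n : is_shape_functions K (bubble_space K n%:Z)
    (fun (k : 'I_n.+1) v => (triangle_area K)^-1 *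
       triangle_int K (fun x => v x * jacobi_K K k n x))
    (fun k x => bubble_coef R n.+2 k * bubble K x ^+ 2 * jacobi_K K k n x).
Proof.
have ak (k : 'I_n.+1) : bubble_coef R n.+2 k * @tjacobi_sqnorm R k (n - k) = 4.
  by have := bubble_coef_sqnorm k (n - k); rewrite subnKC// -ltnS.
have a0 (k : 'I_n.+1) : bubble_coef R n.+2 k != 0.
  by have := bubble_coef_neq0 k (n - k); rewrite subnKC// -ltnS.
have j0 := chart_scale_neq0.
split; last first.
  move=> j k; rewrite triangle_areaE.
  rewrite (@eq_triangle_int _ (fun x => bubble K x ^+ 2 * jacobi_K K j n x *
      (bubble_coef R n.+2 k * jacobi_K K k n x))); last by move=> x _; ring.
  rewrite (@weighted_int_tjacobi_top n
    (fun i => if i == k then bubble_coef R n.+2 k else 0)); last first.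
    move=> x _; rewrite (bigD1 k)//= eqxx big1 ?addr0// => i /negbTE ->.
    by rewrite mul0r.
  have [->|jk] := eqVneq j k; last by rewrite mul0r mulr0.
  by rewrite [X in _ * X]mulrCA ak; transitivity (1 : R) => //; field.
split.
- move=> k; exists (fun x => bubble_coef R n.+2 k * jacobi_K K k n x); last first.
    by move=> x _; ring.
  have kn : (k + (n - k) = n)%N by rewrite subnKC// -ltnS.
  split.
    have lP := @linear_class_Ppoly R K n.
    apply: (linear_classZ _ lP); rewrite -tjacobi_top -[X in Ppoly _ X%:Z]kn.
    exact: tjacobi_Ppoly.
  move=> q qP; rewrite -tjacobi_top.
  rewrite (@eq_triangle_int _ (fun x => bubble K x ^+ 2 * tjacobi K k (n - k) x *
      (bubble_coef R n.+2 k * q x))); last by move=> x _; ring.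
  apply: (tjacobi_orth_lower kn).
  move: (bubble_coef R n.+2 k) => a; case: (n) qP => [|m] qP.
    by move=> x xK; rewrite qP// mulr0.
  rewrite Ppoly_pred in qP *.
  exact: (linear_classZ _ (@linear_class_Ppoly R K m)).
- move=> c c0 k.
  have := @weighted_int_tjacobi_top n
    (fun k => c k * bubble_coef R n.+2 k) k _ (fun _ _ => erefl).
  rewrite (@eq_triangle_int _ (fun=> 0)); last first.
    move=> x xK; rewrite mulrAC -[RHS](mul0r (jacobi_K K k n x)) -[in RHS](c0 x xK).
    congr (_ * _); rewrite mulr_sumr; apply: eq_bigr => i _; ring.
  rewrite {1}/triangle_int /Rintegral integral0/= => /esym/eqP.
  rewrite mulf_eq0 (negbTE (mulf_neq0 j0 (tjacobi_sqnorm_neq0 _ _))) orbF.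
  by rewrite mulf_eq0 (negbTE (a0 k)) orbF => /eqP.
move=> v [w [wP w0] vw].
have [c wc] := Ppoly_tspan_tjacobi wP.
have cE k l : (k + l < n)%N -> c k l = 0.
  move=> kl; have qP : Ppoly K (n%:Z - 1) (tjacobi K k l).
    case: (n) kl => // m kl; rewrite Ppoly_pred.
    have := tjacobi_Ppoly K k l; rewrite !PpolyE; exact: tspan_le.
  have := w0 _ qP.
  rewrite (@eq_triangle_int _ (fun x => bubble K x ^+ 2 * tjacobi K k l x * w x)); last first.
    by move=> x _; ring.
  rewrite (weighted_int_tjacobi k l wc) ltnW// => /eqP.
  by rewrite mulf_eq0 (negbTE (mulf_neq0 j0 (tjacobi_sqnorm_neq0 _ _))) orbF => /eqP.
exists (fun k : 'I_n.+1 => c k (n - k)%N / bubble_coef R n.+2 k) => x xK.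
rewrite vw// wc// mulr_sumr; apply: eq_bigr => i _.
have iN : (i <= n)%N by rewrite -ltnS.
have ni : (n - i < n.+1)%N by rewrite ltnS leq_subr.
rewrite (bigD1 (Ordinal ni)) /= ?subnKC// tjacobi_top big1 ?addr0.
  by move: (a0 i) => ?; field.
move=> l /andP[il]; rewrite -val_eqE/= => ln.
rewrite cE ?mul0r// ltn_neqAle il andbT; apply: contra ln => /eqP iln.
by apply/eqP; lia.
Qed.

End shape.

Theorem lemma3p8 (R : realType) (K : triangle R) (r : nat) (hr : (2 <= r)%N) :
  is_shape_functions K (bubble_space K (r%:Z - 2))
    (fun k : 'I_(r - 1) => bubble_dof K r k)
    (fun k : 'I_(r - 1) => fun x : R * R =>
       bubble_coef R r k * bubble K x ^+ 2 * jacobi_K K k (r - 2) x).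
Proof.
case: r hr => [|[|n]] // _.
have E : (n.+2 - 2 = n)%N by rewrite !subSS subn0.
have -> : n.+2%:Z - 2 = n%:Z by rewrite -(addn2 n) PoszD addrK.
have := shape_functions K n.
by rewrite /bubble_dof E subn1.
Qed.
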